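(* For every $D<\infty$ there exist constants $C_1=C_1(D)>0$ and $C=C(D)>0$ such that for every connected infinite penny graph $G=(V,E,F)$ with $\sup_{\sigma\in F}\deg(\sigma)\le D$ the following hold. (Volume doubling) $|B_{2R}(x)|\le C_1|B_R(x)|$ for all $x\in V$ and $R>0$. (Poincaré inequality) For all $x\in V$, $R>0$ and every function $f:B_{2R}(x)\to\mathbb{R}$, $$\sum_{y\in B_R(x)}|f(y)-\overline f|^2\le C R^2\sum_{\substack{y,z\in B_{2R}(x)\\ y\sim z}}|f(y)-f(z)|^2,\qquad \overline f=\frac1{|B_R(x)|}\sum_{y\in B_R(x)}f(y).$$
   Context: Penny graphs: Let $\{B_i\}_{i=1}^\infty$ be a collection of pairwise disjoint open disks of radius $\frac12$ in $\mathbb{R}^2$, with boundary circles $C_i$ and centers $c_i$. Let $V=\{v_i\}_{i=1}^\infty$, and let $\{v_i,v_j\}\in E$ ($i\ne j$) iff $C_i$ and $C_j$ are tangent, i.e. $|c_i-c_j|=1$. The embedding $\phi$ is given by $\phi(v_i)=c_i$, $\phi(\{v_i,v_j\})=\overline{c_ic_j}$ (the straight segment). The set $F$ of faces corresponds to the connected components of the complement in $\mathbb{R}^2$ of the embedded image of $(V,E)$; for $\sigma\in F$, $\phi(\sigma)$ denotes the corresponding component. The facial degree $\deg(\sigma)\in\mathbb{N}\cup\{\infty\}$ is the number of interior angles (corners at embedded vertices, counted with multiplicity) of the polygonal domain $\phi(\sigma)$. The triple $G=(V,E,F)$ is called an infinite penny graph; it is connected if the graph $(V,E)$ is connected. $y\sim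 z$ means $y,z$ are adjacent, $d$ is the combinatorial (shortest path) distance on $(V,E)$, $B_R(x)=\{y\in V: d(y,x)\le R\}$, and $|\Omega|$ is the number of vertices in $\Omega\subset V$. *)

(* Defs.v *)
From HB Require Import structures.
From mathcomp Require Import all_boot all_order all_algebra.
From mathcomp Require Import all_classical all_reals all_analysis.
From mathcomp Require Import finmap lra.
From mathcomp Require unstable.

Set Implicit Arguments.
Unset Strict Implicit.
Unset Printing Implicit Defensive.

Import Order.TTheory GRing.Theory Num.Theory.
Import numFieldNormedType.Exports.

Local Open Scope classical_set_scope.
Local Open Scope ring_scope.

(* The library norm on R * R is the sup norm; it induces the topology of the
   plane but not its Euclidean metric. *)
Definition euclid_dist (R : realType) (p q : R * R) : R :=
  Num.sqrt ((p.1 - q.1) ^+ 2 + (p.2 - q.2) ^+ 2).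

Definition open_disk (R : realType) (p : R * R) (rho : R) : set (R * R) :=
  [set q | euclid_dist p q < rho].

Definition segment (R : realType) (p q : R * R) : set (R * R) :=
  [set ((1 - t) * p.1 + t * q.1, (1 - t) * p.2 + t * q.2) | t in `[0, 1]].

Definition components (R : realType) (A : set (R * R)) : set (set (R * R)) :=
  [set connected_component A p | p in A].

(* An infinite penny graph is given by its sequence of centers c; the vertex
   v_i is the index i : nat. *)
Definition penny_packing (R : realType) (c : nat -> R * R) : Prop :=
  trivIset [set: nat] (fun i => open_disk (c i) (1 / 2)).

Definition adj (R : realType) (c : nat -> R * R) : rel nat :=
  fun i j => (i != j) && (euclid_dist (c i) (c j) == 1).

Definition embedded_image (R : realType) (c : nat -> R * R) : set (R * R) :=
  range c `|` \bigcup_(e in [set e : nat * nat | adj c e.1 e.2])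
                segment (c e.1) (c e.2).

Definition faces (R : realType) (c : nat -> R * R) : set (set (R * R)) :=
  components (~` embedded_image c).

(* The open disk of radius 1/2 around c i meets the embedded image exactly in
   the initial halves of the edges at i (any other edge is at distance at least
   sqrt 3 / 2), hence its complement there is the disjoint union of the open
   sectors between consecutive edges.  A corner of a face U at the vertex i is
   one such sector contained in U; U has several corners at i when its boundary
   passes several times through i.  A vertex of degree one carries a single
   corner, of angle 2 pi. *)
Definition corners (R : realType) (c : nat -> R * R) (U : set (R * R)) :
    set (nat * set (R * R)) :=
  [set a | components (U `&` open_disk (c a.1) (1 / 2)) a.2].

Definition facial_degree (R : realType) (c : nat -> R * R) (U : set (R * R)) :
    \bar R :=
  counting (corners c U).

Definition graph_connected (V : eqType) (e : rel V) : Prop :=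
  forall x y : V, exists2 p : seq V, path e x p & last x p = y.

(* Equals +oo when no walk joins x to y. *)
Definition graph_dist (R : realType) (V : eqType) (e : rel V) (x y : V) :
    \bar R :=
  ereal_inf [set ((size p)%:R)%:E | p in [set p | path e x p /\ last x p = y]].

Definition graph_ball (R : realType) (V : eqType) (e : rel V) (x : V) (r : R) :
    set V :=
  [set y | (graph_dist R e y x <= r%:E)%E].

Definition ncard (R : realType) (V : choiceType) (A : set V) : R :=
  (#|` fset_set A|)%:R.

Definition mean (R : realType) (V : choiceType) (A : set V) (f : V -> R) : R :=
  (ncard R A)^-1 * \sum_(y \in A) f y.

Lemma adj_sym (R : realType) (c : nat -> R * R) : symmetric (adj c).
Proof.
move=> i j; rewrite /adj eq_sym /euclid_dist.
by rewrite -(sqrrN ((c i).1 - _)) -(sqrrN ((c i).2 - _)) !opprB.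
Qed.

Lemma neighbours_finite (R : realType) (c : nat -> R * R) (i : nat) :
  penny_packing c -> finite_set [set j | adj c i j].
Proof.
move=> pc.
pose cell j := (Num.floor (2 * ((c i).1 - (c j).1)),
                Num.floor (2 * ((c i).2 - (c j).2))).
have cellP (a b : R) : Num.floor a = Num.floor b -> (a - b) ^+ 2 < 1.
  move=> eab; have := floor_itv a; have := floor_itv b; rewrite eab intrD.
  by move=> /andP[b1 b2] /andP[a1 a2]; nra.
have inj : injective cell.
  move=> j k [/cellP h1 /cellP h2]; apply: pc => //.
  exists (((c j).1 + (c k).1) / 2, ((c j).2 + (c k).2) / 2).
  have s4 : Num.sqrt ((1 / 2) ^+ 2) = 1 / 2 :> R.
    by rewrite sqrtr_sqr ger0_norm//; lra.
  by split; rewrite /open_disk /euclid_dist /= -s4 ltr_sqrt; nra.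
have bnd (u v : R) : Num.sqrt (u ^+ 2 + v ^+ 2) = 1 -> -1 <= u <= 1.
  move=> /(congr1 (fun z => z ^+ 2)); rewrite sqr_sqrtr ?addr_ge0 ?sqr_ge0//.
  by move=> h; apply/andP; split; nra.
pose s : seq int := [:: -2; -1; 0; 1; 2]%R.
have ins (u : R) : -1 <= u <= 1 -> Num.floor (2 * u) \in s.
  move=> /andP[u1 u2].
  have : (-2 <= Num.floor (2 * u) < 3)%R.
    by rewrite floor_ge_int floor_lt_int; apply/andP; split; lra.
  by case: (Num.floor _) => [[|[|[|n]]]|[|[|n]]].
rewrite -(eq_finite_set (inj_card_eq (in2W inj))).
apply: (@sub_finite_set _ _ ([set` s] `*` [set` s])); last exact: finite_setX.
move=> _ [j /andP[_ /eqP dij] <-]; split; apply: ins.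
  exact: bnd dij.
by rewrite /euclid_dist addrC in dij; exact: bnd dij.
Qed.

(* So the junk value of fset_set on infinite sets, and that of \sum_(y \in A) for
   functions of infinite support, never arise for balls of a penny graph. *)
Lemma graph_ball_finite (R : realType) (c : nat -> R * R) (x : nat) (r : R) :
  penny_packing c -> finite_set (graph_ball (adj c) x r).
Proof.
move=> pc.
pose W n := [set y | exists p, [/\ path (adj c) y p, last y p = x & size p = n]].
have Wfin n : finite_set (W n).
  elim: n => [|n IH].
    apply: (sub_finite_set _ (finite_set1 x)).
    by move=> y [p [_ + /size0nil p0]]; rewrite p0.
  apply: (@sub_finite_set _ _ (\bigcup_(z in W n) [set y | adj c z y])).
    move=> y [[|z q] [//= /andP[yz pq] lq [sq]]].
    by exists z; [exists q|rewrite /= adj_sym].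
  by apply: bigcup_finite => // z _; exact: neighbours_finite.
have [N rN] : exists N : nat, r < N%:R.
  by exists (Num.bound r); exact: unstable.ltr_bound.
apply: (@sub_finite_set _ _ (\bigcup_(n in `I_N) W n)); last first.
  exact: bigcup_finite.
move=> y; rewrite /graph_ball /= => ry.
have : (graph_dist R (adj c) y x < N%:R%:E)%E.
  by apply: le_lt_trans ry _; rewrite lte_fin.
rewrite /graph_dist => /ereal_inf_lt[_ [p [pp lp] <-]]; rewrite lte_fin ltr_nat => pN.
by exists (size p) => //; exists p.
Qed.

(* Main.v *)
Require Import Defs.
From mathcomp Require Import all_boot all_order all_algebra.
From mathcomp Require Import all_classical all_reals all_analysis.
From mathcomp Require Import finmap lra ring.

Import Order.TTheory GRing.Theory Num.Theory.
Import numFieldNormedType.Exports.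

Local Open Scope classical_set_scope.
Local Open Scope ring_scope.

(** The boundary of a face [U] is covered by edges whose ends are vertices in the
    closure of [U]; each such vertex carries a corner of [U], so there are at most
    [D] of them.  Both [U] and its complement are connected (the graph is), so by
    unicoherence of the plane the boundary of [U] is connected, and hence so is the
    subgraph induced on these vertices.  Therefore they are within graph distance
    [D] of each other; and [U] has diameter [O(D)], for otherwise [U] would contain
    the outside of a large square and the graph would be finite.  Following the
    faces met by an L-shaped path between two centers yields a path of the graph
    in a bounded neighbourhood of it, whose length is at most linear since pennies
    are disjoint.  So balls of radius [r] have about [r ^ 2] vertices, whence
    doubling, and sending a flow along these paths gives a Poincare inequality in
    balls of radius [r / M], in which the paths stay in the ball of radius [2 r].
    Comparing averages over small balls along geodesics to the center
    gives the inequality on the ball of radius [r]. *)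

Set Implicit Arguments.
Unset Strict Implicit.
Unset Printing Implicit Defensive.

(** * Connectedness in the plane *)

(** Unicoherence is proved by a covering argument. If two connected open sets cover the plane and
    their intersection splits into disjoint open sets [P] and [Q], gluing the two sets straight
    along [P] and crosswise along [Q] defines a double cover. It has a section over the whole plane,
    since it is trivial on small cells, and such a section forbids [P] and [Q] from both being
    nonempty. All that is used about the drawing of the graph is metric: links without a common end
    stay a fixed distance apart, and links from a common end separate linearly. Comparing averages
    costs only a constant because the number of averages between a vertex and the center depends on
    [D] alone, while the lower volume bound controls the reciprocals of the volumes. *)

Definition locally_constant (T : topologicalType) (A : set T) (s : T -> bool) :=
  forall z, A z -> \forall y \near z, A y -> s y = s z.

Lemma connected_locally_constant (T : topologicalType) (A : set T) (s : T -> bool) :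
  connected A -> locally_constant A s ->
  forall x y, A x -> A y -> s x = s y.
Proof.
move=> cA sA x y Ax Ay.
pose B := A `&` [set z | s z = s x].
suff BA : B = A by have : A y by []; rewrite -BA => -[_ ->].
apply: cA; first by exists x.
- exists (interior [set z | A z -> s z = s x]); first exact: open_interior.
  apply/seteqP; split=> z /= [Az]; last by move=> /nbhs_singleton zx; split=> //; exact: zx.
  by move=> zx; split=> //; rewrite -zx; exact: sA.
- exists (~` interior [set z | A z -> s z <> s x]).
    by apply: open_closedC; exact: open_interior.
  apply/seteqP; split=> z /= [Az].
    by move=> zx; split=> // /nbhs_singleton /(_ Az).
  move=> h; split=> //; apply: contrapT => zx; apply: h.
  by have := sA _ Az; apply: filterS => w /[apply] ->.
Qed.

Lemma locally_constant_connected (T : topologicalType) (A : set T) :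
  (forall s, locally_constant A s -> forall x y, A x -> A y -> s x = s y) ->
  connected A.
Proof.
move=> h B [b Bb] [C oC BC] [D cD BD].
apply/seteqP; split=> y; first by rewrite BC => -[].
move=> Ay; have Ab : A b by move: Bb; rewrite BC => -[].
suff : `[< B b >] = `[< B y >] by rewrite (asboolT Bb) => /esym/asboolP.
apply: (h (fun y => `[< B y >])) => // z Az.
have [Bz|nBz] := pselect (B z).
  have Cz : C z by move: Bz; rewrite BC => -[].
  have : nbhs z C by exact: open_nbhs_nbhs.
  apply: filterS => w Cw Aw; rewrite (asboolT Bz); apply/asboolT.
  by rewrite BC.
have nDz : (~` D) z by move=> Dz; apply: nBz; rewrite BD.
have : nbhs z (~` D) by apply: open_nbhs_nbhs; split=> //; exact: closed_openC.
apply: filterS => w Dw Aw; rewrite (asboolF nBz); apply/asboolF.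
by rewrite BD => -[].
Qed.

(** The last hypothesis keeps [L] off the boundary of [U], so [U] is relatively clopen in [L]. *)
Lemma connected_sub_open (T : topologicalType) (U L : set T) :
  open U -> connected L -> L `&` U !=set0 -> L `&` closure U `<=` U -> L `<=` U.
Proof.
move=> oU cL [x [Lx Ux]] h y Ly.
suff : `[< U x >] = `[< U y >] by rewrite (asboolT Ux) => /esym/asboolP.
apply: (connected_locally_constant cL (s := fun z => `[< U z >])) => // z Lz.
have [Uz|nUz] := pselect (U z).
  have : nbhs z U by exact: open_nbhs_nbhs.
  by apply: filterS => w Uw _; rewrite !asboolT.
have ncl : (~` closure U) z by move=> cz; apply: nUz; apply: h.
have : nbhs z (~` closure U).
  apply: open_nbhs_nbhs; split=> //; apply: closed_openC; exact: closed_closure.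
apply: filterS => w Uw _; rewrite !asboolF// => Uw'; apply: Uw.
exact: subset_closure.
Qed.

Section plane.
Variable R : realType.
Local Notation T := (R * R)%type.
Implicit Types (p q z y : T) (A B K P Q U : set T).

Lemma ball_planeE z e y :
  ball z e y = (`|z.1 - y.1| < e /\ `|z.2 - y.2| < e) :> Prop.
Proof. by []. Qed.

Lemma segment_continuous p q :
  continuous (fun t : R => ((1 - t) * p.1 + t * q.1, (1 - t) * p.2 + t * q.2)).
Proof.
have c1 : continuous (fun t : R => 1 - t).
  by move=> t; apply: cvgB; [exact: cvg_cst|exact: cvg_id].
have c2 (a b : R) : continuous (fun t : R => (1 - t) * a + t * b).
  by move=> t; apply: cvgD; apply: cvgM; by [exact: cvg_cst|exact: cvg_id|exact: c1].
move=> t; exact: cvg_pair (c2 _ _ t) (c2 _ _ t).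
Qed.

Lemma connected_segment p q : connected (segment p q).
Proof.
apply: connected_continuous_connected; first exact: segment_connected.
by apply: continuous_subspaceT; exact: segment_continuous.
Qed.

Lemma closed_segment p q : closed (segment p q).
Proof.
apply: compact_closed; first exact: norm_hausdorff.
apply: continuous_compact; last exact: segment_compact.
by apply: continuous_subspaceT; exact: segment_continuous.
Qed.

Lemma segment_left p q : segment p q p.
Proof.
exists 0; first by rewrite /= in_itv /= lexx ler01.
by rewrite !subr0 !mul1r !mul0r !addr0; case: p.
Qed.

Lemma segment_right p q : segment p q q.
Proof.
exists 1; first by rewrite /= in_itv /= lexx ler01.
by rewrite !subrr !mul1r !mul0r !add0r; case: q.
Qed.

Lemma segmentC p q : segment p q `<=` segment q p.
Proof.
move=> w [t /=]; rewrite in_itv /= => /andP[t0 t1] <-.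
exists (1 - t); first by rewrite /= in_itv /=; apply/andP; split; lra.
by congr pair; ring.
Qed.

Lemma star_connected A p :
  (forall q, A q -> segment p q `<=` A) -> connected A.
Proof.
move=> h; apply: locally_constant_connected => s sA.
have hp q : A q -> s p = s q.
  move=> Aq; apply: (connected_locally_constant (connected_segment (p := p) (q := q)) (s := s)).
  - move=> z zpq; have Az : A z by exact: (h q).
    by have := sA _ Az; apply: filterS => y + ypq; apply; exact: (h q).
  - exact: segment_left.
  - exact: segment_right.
by move=> x y Ax Ay; rewrite -(hp x)// (hp y).
Qed.

Lemma convex_lt (a b e t : R) : 0 <= t <= 1 -> a < e -> b < e -> (1 - t) * a + t * b < e.
Proof.
move=> /andP[t0 t1] ae be; move: t0; rewrite le_eqVlt => /orP[/eqP<-|t0]; first by lra.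
have : 0 < t * (e - b) by apply: mulr_gt0 => //; lra.
have : 0 <= (1 - t) * (e - a) by apply: mulr_ge0; lra.
lra.
Qed.

Lemma segment_ball z e p q : ball z e p -> ball z e q -> segment p q `<=` ball z e.
Proof.
rewrite !ball_planeE => -[h1 h2] [h3 h4] w [t /=].
rewrite in_itv /= => /andP[t0 t1] <-; move: h1 h2 h3 h4.
rewrite !ltr_norml => /andP[a1 a2] /andP[b1 b2] /andP[c1 c2] /andP[d1 d2].
have t01 : 0 <= t <= 1 by rewrite t0.
rewrite ball_planeE /= !ltr_norml; split; apply/andP; split.
- by have := @convex_lt (p.1 - z.1) (q.1 - z.1) e t t01; lra.
- by have := @convex_lt (z.1 - p.1) (z.1 - q.1) e t t01; lra.
- by have := @convex_lt (p.2 - z.2) (q.2 - z.2) e t t01; lra.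
- by have := @convex_lt (z.2 - p.2) (z.2 - q.2) e t t01; lra.
Qed.

Lemma connected_ball z e : 0 < e -> connected (ball z e).
Proof.
move=> e0; apply: (@star_connected _ z) => q zq.
by apply: segment_ball => //; exact: ballxx.
Qed.

Lemma open_component A z : open A -> open (connected_component A z).
Proof.
move=> oA; have [Az|nAz] := pselect (A z); last first.
  by rewrite connected_component_out//; exact: open0.
move=> y Cy; have Ay := connected_component_sub Cy.
have /nbhs_ballP[e e0 eA] : nbhs y A by exact: open_nbhs_nbhs.
apply/nbhs_ballP; exists e => // w yw.
apply: connected_component_trans Cy _.
by exists (ball y e) => //; split=> //; [exact: ballxx|exact: connected_ball].
Qed.

Lemma component_boundary A z y : open A ->
  closure (connected_component A z) y -> A y -> connected_component A z y.
Proof.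
move=> oA cy Ay.
have /nbhs_ballP[e e0 eA] : nbhs y A by exact: open_nbhs_nbhs.
have [w [Cw yw]] := cy _ (nbhsx_ballx y e e0).
apply: connected_component_trans Cw _.
by exists (ball y e); [split=> //; exact: connected_ball|exact: ballxx].
Qed.

End plane.

(** * Unicoherence of the plane *)

Lemma locally_constant_subset (T : topologicalType) (A B : set T) (s : T -> bool) :
  A `<=` B -> locally_constant B s -> locally_constant A s.
Proof. by move=> AB h z /AB /h; apply: filterS => y + /AB. Qed.

(** A point outside the closed set [K1] has a neighbourhood without points of [K1], and likewise for
    [K2], so each piece matters only near its own points. *)
Lemma locally_constant_glue (T : topologicalType) (A K1 K2 : set T) (s1 s2 : T -> bool) :
  closed K1 -> closed K2 ->
  locally_constant (A `&` K1) s1 -> locally_constant (A `&` K2) s2 ->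
  (forall y, K1 y -> K2 y -> s1 y = s2 y) ->
  locally_constant (A `&` (K1 `|` K2)) (fun y => if `[< K1 y >] then s1 y else s2 y).
Proof.
move=> c1 c2 l1 l2 e z [Az Kz].
have near_of (K : set T) s : closed K -> locally_constant (A `&` K) s ->
    \forall y \near z, A y -> K y -> K z /\ s y = s z.
  move=> cK lK; have [Kz'|nKz] := pselect (K z).
    by have := lK _ (conj Az Kz'); apply: filterS => y h Ay Ky; split=> //; exact: h.
  have : nbhs z (~` K) by apply: open_nbhs_nbhs; split=> //; exact: closed_openC.
  by apply: filterS => y nKy _ /nKy.
have := near_of _ _ c1 l1; have := near_of _ _ c2 l2.
apply: filterS2 => y h2 h1 [Ay Ky].
case: asboolP => K1y.
  by have [K1z ->] := h1 Ay K1y; rewrite asboolT.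
have {}Ky : K2 y by case: Ky.
have [K2z ->] := h2 Ay Ky; case: asboolP => // K1z.
by rewrite e.
Qed.

Section double_cover.
Variables (T : topologicalType) (A B P Q : set T).
Hypotheses (oA : open A) (oB : open B) (oP : open P) (oQ : open Q).
Hypotheses (ABT : forall z, A z \/ B z) (PQ0 : forall z, P z -> Q z -> False).
Hypothesis ABPQ : forall z, A z -> B z -> P z \/ Q z.

(* Sections over [K] of the double cover of the plane obtained by gluing two
   copies of [A] to two copies of [B], straight along [P] and crosswise along
   [Q]: [s] is the sheet over [A], and [s (+) Q] the sheet over [B]. *)
Definition cover_section (K : set T) (s : T -> bool) :=
  locally_constant (A `&` K) s /\
  locally_constant (B `&` K) (fun y => s y (+) `[< Q y >]).

Lemma cover_section_subset K K' s : K `<=` K' -> cover_section K' s -> cover_section K s.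
Proof.
by move=> KK' [h1 h2]; split; [move: h1|move: h2];
  apply: locally_constant_subset => z [? /KK'].
Qed.

Let locally_constant_Q : locally_constant (A `&` B) (fun y => `[< Q y >]).
Proof.
move=> z [Az Bz]; have [Pz|Qz] := ABPQ Az Bz.
  have : nbhs z P by exact: open_nbhs_nbhs.
  by apply: filterS => y Py _; rewrite !asboolF// => /PQ0; exact.
have : nbhs z Q by exact: open_nbhs_nbhs.
by apply: filterS => y Qy _; rewrite !asboolT.
Qed.

(** The cover is trivial over each of the two sets: over [A] take the sheet [false]; over [B] take
    [s = Q], which makes [s (+) Q] vanish. *)
Lemma cover_section_local K : K `<=` A \/ K `<=` B -> exists s, cover_section K s.
Proof.
move=> [KA|KB].
  exists (fun=> false); split; first by move=> z _; apply: nearW.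
  by apply: locally_constant_subset locally_constant_Q => z [? /KA].
exists (fun y => `[< Q y >]); split.
  by apply: locally_constant_subset locally_constant_Q => z [? /KB].
by move=> z _; apply: nearW => y _; rewrite !addbb.
Qed.

(** In the difference of two sections the twist by [Q] cancels, so it is locally constant over [A]
    and over [B] alike. *)
Lemma cover_section_addb K s1 s2 : connected K ->
  cover_section K s1 -> cover_section K s2 ->
  forall x y, K x -> K y -> s1 x (+) s2 x = s1 y (+) s2 y.
Proof.
move=> cK [a1 b1] [a2 b2].
apply: (connected_locally_constant (s := fun x => s1 x (+) s2 x) cK) => z Kz.
have [Az|Bz] := ABT z.
  have nA : nbhs z A by exact: open_nbhs_nbhs.
  have := a1 _ (conj Az Kz); have := a2 _ (conj Az Kz).
  by apply: filterS3 nA => y Ay h2 h1 Ky; rewrite h1// h2.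
have nB : nbhs z B by exact: open_nbhs_nbhs.
have := b1 _ (conj Bz Kz); have := b2 _ (conj Bz Kz).
apply: filterS3 nB => y By h2 h1 Ky.
have := h1 (conj By Ky); have := h2 (conj By Ky).
by case: (s1 y); case: (s1 z); case: (s2 y); case: (s2 z);
  case: `[< Q y >]; case: `[< Q z >].
Qed.

Lemma cover_section_shift K s b :
  cover_section K s -> cover_section K (fun y => s y (+) b).
Proof.
move=> [h1 h2]; split => z /[dup] Kz.
  by move=> /h1; apply: filterS => y /[apply] ->.
by move=> /h2; apply: filterS => y /[apply]; rewrite ![_ (+) b]addbC -!addbA => ->.
Qed.

(** On the connected overlap the two sections differ by a constant; shifting the second one by it
    makes them agree. *)
Lemma cover_section_glue K1 K2 : closed K1 -> closed K2 ->
  connected (K1 `&` K2) -> K1 `&` K2 !=set0 ->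
  (exists s, cover_section K1 s) -> (exists s, cover_section K2 s) ->
  exists s, cover_section (K1 `|` K2) s.
Proof.
move=> c1 c2 c12 [x [K1x K2x]] [s1 g1] [s2 g2].
have e y : K1 y -> K2 y -> s1 y = s2 y (+) (s1 x (+) s2 x).
  move=> K1y K2y.
  have -> : s1 x (+) s2 x = s1 y (+) s2 y.
    apply: (cover_section_addb c12) => //.
      by apply: cover_section_subset g1 => z [].
    by apply: cover_section_subset g2 => z [].
  by case: (s1 y); case: (s2 y).
have [g3 g4] := cover_section_shift (s1 x (+) s2 x) g2; case: g1 => g1 g2'.
exists (fun y => if `[< K1 y >] then s1 y else s2 y (+) (s1 x (+) s2 x)); split.
  exact: locally_constant_glue.
rewrite (_ : (fun y => _) = fun y => if `[< K1 y >] then s1 y (+) `[< Q y >]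
    else (s2 y (+) (s1 x (+) s2 x)) (+) `[< Q y >]).
  by apply: locally_constant_glue => // y K1y K2y; rewrite e.
by apply/funext => y; case: ifP.
Qed.

End double_cover.

(** * Sections over rectangles, squares and the whole plane *)

Section plane.
Variable R : realType.
Local Notation T := (R * R)%type.
Implicit Types (a b e : R) (A B K P Q : set T).

Definition rectangle a b c d : set T := [set z | a <= z.1 <= b /\ c <= z.2 <= d].

Lemma rectangleE a b c d : rectangle a b c d = `[a, b] `*` `[c, d].
Proof. by apply/seteqP; split=> z; rewrite /rectangle /= !in_itv. Qed.

Lemma compact_rectangle a b c d : compact (rectangle a b c d).
Proof. by rewrite rectangleE; apply: compact_setX; exact: segment_compact. Qed.

Lemma closed_rectangle a b c d : closed (rectangle a b c d).
Proof. by apply: compact_closed; [exact: norm_hausdorff|exact: compact_rectangle]. Qed.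

Lemma connected_rectangle a b c d : connected (rectangle a b c d).
Proof.
have [[p [p1 p2]]|/nonemptyPn ->] := pselect (rectangle a b c d !=set0);
  last exact: connected0.
apply: (@star_connected _ _ p) => q [q1 q2] z [t /=]; rewrite in_itv /= => t01 <-.
move: p1 p2 q1 q2 t01 => /andP[? ?] /andP[? ?] /andP[? ?] /andP[? ?] /andP[? ?].
by split => /=; apply/andP; split; nra.
Qed.

Lemma lebesgue_number K A B : compact K -> open A -> open B -> K `<=` A `|` B ->
  exists2 e, 0 < e & forall x, K x -> ball x e `<=` A \/ ball x e `<=` B.
Proof.
move=> /compact_near_coveringP cK oA oB KAB.
pose S e x := ball x e `<=` A \/ ball x e `<=` B.
have half (C : set T) x : open C -> C x ->
    \forall x' \near x & e \near 0^'+, ball x' e `<=` C.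
  move=> oC Cx; have /nbhs_ballP[d d0 dC] : nbhs x C by exact: open_nbhs_nbhs.
  exists (ball x (d / 2), [set e | e < d / 2]) => /=.
    split; first by apply: nbhsx_ballx; rewrite divr_gt0.
    by apply: nbhs_right_lt; rewrite divr_gt0.
  move=> [x' e] /= [xx' ed] y x'y; apply: dC.
  by apply: (ball_split xx'); apply: le_ball x'y; exact: ltW.
have [e [e0 eS]] : exists e : R, 0 < e /\ K `<=` S e; last by exists e.
  suff : \forall e \near 0^'+, K `<=` S e.
    by move=> h; near (0:R)^'+ => e; exists e; split => //; near: e.
  apply: cK => x /KAB[Ax|Bx].
    by have := half _ _ oA Ax; apply: filterS => -[? ?] ?; left.
  by have := half _ _ oB Bx; apply: filterS => -[? ?] ?; right.
Unshelve. all: by end_near. Qed.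

Section plane_cover.
Variables A B P Q : set T.
Hypotheses (oA : open A) (oB : open B) (oP : open P) (oQ : open Q).
Hypotheses (ABT : forall z, A z \/ B z) (PQ0 : forall z, P z -> Q z -> False).
Hypothesis ABPQ : forall z, A z -> B z -> P z \/ Q z.

Lemma cover_section_hglue a b b' c d : a <= b -> b <= b' -> c <= d ->
  (exists s, cover_section A B Q (rectangle a b c d) s) ->
  (exists s, cover_section A B Q (rectangle b b' c d) s) ->
  exists s, cover_section A B Q (rectangle a b' c d) s.
Proof.
move=> ab bb' cd g1 g2.
have -> : rectangle a b' c d = rectangle a b c d `|` rectangle b b' c d.
  apply/seteqP; split=> z; rewrite /rectangle /=.
    move=> [/andP[h1 h2] h3]; have [h|/ltW h] := leP z.1 b; [left|right];
      by split=> //; apply/andP.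
  by move=> [|] [/andP[h1 h2] h3]; split=> //; apply/andP; split=> //; lra.
apply: (cover_section_glue oA oB ABT) => //; try exact: closed_rectangle.
- rewrite (_ : _ `&` _ = rectangle b b c d); first exact: connected_rectangle.
  apply/seteqP; split=> z; rewrite /rectangle /=.
    by move=> [[/andP[h1 h2] h3] [/andP[h4 h5] h6]]; split=> //; apply/andP; split.
  by move=> [/andP[h1 h2] h3]; split; split=> //; apply/andP; split; lra.
- by exists (b, c); split; rewrite /rectangle /= ?lexx ?ab ?bb' ?cd.
Qed.

Lemma cover_section_vglue a b c d d' : a <= b -> c <= d -> d <= d' ->
  (exists s, cover_section A B Q (rectangle a b c d) s) ->
  (exists s, cover_section A B Q (rectangle a b d d') s) ->
  exists s, cover_section A B Q (rectangle a b c d') s.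
Proof.
move=> ab cd dd' g1 g2.
have -> : rectangle a b c d' = rectangle a b c d `|` rectangle a b d d'.
  apply/seteqP; split=> z; rewrite /rectangle /=.
    move=> [h3 /andP[h1 h2]]; have [h|/ltW h] := leP z.2 d; [left|right];
      by split=> //; apply/andP.
  by move=> [|] [h3 /andP[h1 h2]]; split=> //; apply/andP; split=> //; lra.
apply: (cover_section_glue oA oB ABT) => //; try exact: closed_rectangle.
- rewrite (_ : _ `&` _ = rectangle a b d d); first exact: connected_rectangle.
  apply/seteqP; split=> z; rewrite /rectangle /=.
    by move=> [[h3 /andP[h1 h2]] [h6 /andP[h4 h5]]]; split=> //; apply/andP; split.
  by move=> [h3 /andP[h1 h2]]; split; split=> //; apply/andP; split; lra.
- by exists (a, d); split; rewrite /rectangle /= ?lexx ?ab ?dd' ?cd.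
Qed.

(** A grid finer than the Lebesgue number has each cell inside [A] or inside [B]; cells are glued
    into rows, and rows into the square, along common sides. *)
Lemma cover_section_square a b (L : R) : 0 < L ->
  exists s, cover_section A B Q (rectangle a (a + L) b (b + L)) s.
Proof.
move=> L0.
have [e e0 he] := @lebesgue_number (rectangle a (a + L) b (b + L)) A B
  (@compact_rectangle _ _ _ _) oA oB (fun z _ => ABT z).
pose n := (Num.bound (L / e)).+1; pose del := L / n%:R.
have n0 : 0 < n%:R :> R by rewrite ltr0n.
have del0 : 0 < del by rewrite divr_gt0.
have dele : del < e.
  rewrite ltr_pdivrMr// mulrC -ltr_pdivrMr//.
  apply: lt_trans (_ : (Num.bound (L / e))%:R < _); last by rewrite ltr_nat.
  by apply: unstable.ltr_bound.
have nL : n%:R * del = L by rewrite mulrC divfK// gt_eqF.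
have cell i j : (i < n)%N -> (j < n)%N -> exists s, cover_section A B Q
    (rectangle (a + i%:R * del) (a + i.+1%:R * del)
       (b + j%:R * del) (b + j.+1%:R * del)) s.
  move=> ilt jlt; apply: (cover_section_local oP oQ PQ0 ABPQ) => //.
  have le_nL k : (k < n)%N -> 0 <= k%:R * del <= L.
    move=> kn; apply/andP; split; first by apply: mulr_ge0; rewrite ?ler0n// ltW.
    by rewrite -nL ler_pM2r// ler_nat ltnW.
  have /he : rectangle a (a + L) b (b + L) (a + i%:R * del, b + j%:R * del).
    by move: (le_nL _ ilt) (le_nL _ jlt) => /andP[? ?] /andP[? ?];
      split; apply/andP; split=> /=; lra.
  have sub : rectangle (a + i%:R * del) (a + i.+1%:R * del)
       (b + j%:R * del) (b + j.+1%:R * del) `<=` ball (a + i%:R * del, b + j%:R * del) e.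
    move=> z [/andP[h1 h2] /andP[h3 h4]]; move: h2 h4; rewrite -!natr1 => h2 h4.
    by rewrite ball_planeE /= !ltr_norml; split; apply/andP; split; lra.
  by move=> [h|h]; [left|right]; exact: subset_trans sub h.
have le_step (x : R) k : x + k%:R * del <= x + k.+1%:R * del.
  by rewrite lerD2l ler_pM2r// ler_nat.
have le_base (x : R) k : x <= x + k%:R * del.
  by rewrite lerDl; apply: mulr_ge0; rewrite ?ler0n// ltW.
have row j k : (j < n)%N -> (k <= n)%N -> exists s, cover_section A B Q
    (rectangle a (a + k%:R * del) (b + j%:R * del) (b + j.+1%:R * del)) s.
  move=> jn; elim: k => [_|k IH kn].
    have [s gs] := cell 0%N j isT jn; exists s; apply: cover_section_subset gs.
    move=> z; rewrite /rectangle /= mul0r addr0 mul1r => -[/andP[h1 h2] h3].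
    by split=> //; apply/andP; split; lra.
  apply: (@cover_section_hglue _ (a + k%:R * del)) => //.
    by apply: IH; exact: ltnW.
  exact: cell.
have rows k : (k <= n)%N -> exists s, cover_section A B Q
    (rectangle a (a + n%:R * del) b (b + k%:R * del)) s.
  elim: k => [_|k IH kn].
    have [s gs] := row 0%N n isT (leqnn n); exists s; apply: cover_section_subset gs.
    move=> z; rewrite /rectangle /= mul0r addr0 mul1r => -[h3 /andP[h1 h2]].
    by split=> //; apply/andP; split; lra.
  apply: (@cover_section_vglue _ _ _ (b + k%:R * del)) => //.
    by apply: IH; exact: ltnW.
  exact: row.
by have := rows n (leqnn n); rewrite nL.
Qed.

(** Sections over growing squares, normalised to be [false] at the origin, agree on common points
    because each square is connected. *)
Lemma cover_section_plane : exists s, cover_section A B Q setT s.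
Proof.
pose K n := rectangle (- n.+1%:R) (n.+1%:R) (- n.+1%:R) (n.+1%:R : R).
have ex n : exists s, cover_section A B Q (K n) s.
  have := @cover_section_square (- n.+1%:R) (- n.+1%:R) (n.+1%:R + n.+1%:R).
  by rewrite addrA addNr add0r; apply; rewrite addr_gt0// ltr0n.
have K0 n : K n (0, 0).
  by rewrite /K /rectangle /= oppr_le0 ler0n.
have Kle m n : (m <= n)%N -> K m `<=` K n.
  move=> mn z; rewrite /K /rectangle /=.
  have : m.+1%:R <= n.+1%:R :> R by rewrite ler_nat ltnS.
  by move=> h [/andP[? ?] /andP[? ?]]; split; apply/andP; split; lra.
have /choice[s0 s0P] := ex.
pose s n y := s0 n y (+) s0 n (0, 0).
have sP n : cover_section A B Q (K n) (s n) by exact: cover_section_shift.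
have s00 n : s n (0, 0) = false by rewrite /s addbb.
have sle m n z : (m <= n)%N -> K m z -> s m z = s n z.
  move=> mn Kz; have := cover_section_addb oA oB ABT
    (@connected_rectangle _ _ _ _) (sP m) (cover_section_subset (Kle _ _ mn) (sP n))
    (K0 m) Kz.
  by rewrite !s00; case: (s m z); case: (s n z).
have sE m n z : K m z -> K n z -> s m z = s n z.
  by move=> Km Kn; case: (leqP m n) => [|/ltnW] mn; [|symmetry]; exact: sle.
have Knbhs (z : T) : exists n, nbhs z (K n).
  pose n := Num.bound (`|z.1| + `|z.2| + 1); exists n.
  have h : `|z.1| + `|z.2| + 1 < n.+1%:R :> R.
    by apply: lt_trans (_ : n%:R < _); [exact: unstable.ltr_bound|rewrite ltr_nat].
  apply/nbhs_ballP; exists 1 => //= y; rewrite ball_planeE !ltr_norml.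
  move=> [/andP[h1 h2] /andP[h3 h4]].
  have := normr_ge0 z.1; have := normr_ge0 z.2.
  have nn (x : R) : - `|x| <= x <= `|x| by rewrite -ler_norml.
  have /andP[? ?] := nn z.1; have /andP[? ?] := nn z.2.
  by rewrite /K /rectangle /=; move=> *; split; apply/andP; split; lra.
have /choice[N NP] := Knbhs.
have NK z : K (N z) z by exact: nbhs_singleton.
(* [N] may jump from point to point; by [sE] the value does not depend on the square chosen. *)
exists (fun z => s (N z) z); split => z [Cz _].
  have := (sP (N z)).1 _ (conj Cz (NK z)); apply: filterS2 (NP z) => y Ky h [Cy _].
  by rewrite (sE (N y) (N z))//; exact: h.
have := (sP (N z)).2 _ (conj Cz (NK z)); apply: filterS2 (NP z) => y Ky h [Cy _].
by rewrite (sE (N y) (N z))//; exact: h.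
Qed.

(** A global section [s] is constant on [A], so it takes the same value at [p] and [q]; but
    [s (+) Q] is constant on [B], so the values differ. *)
Lemma unicoherent_plane p q : connected A -> connected B ->
  (forall z, P z -> A z /\ B z) -> (forall z, Q z -> A z /\ B z) ->
  P p -> Q q -> False.
Proof.
move=> cA cB PAB QAB Pp Qq; have [s [sA sB]] := cover_section_plane.
have [Ap Bp] := PAB _ Pp; have [Aq Bq] := QAB _ Qq.
rewrite setIT in sA; rewrite setIT in sB.
have h1 := connected_locally_constant cA sA Ap Aq.
have := connected_locally_constant cB sB Bp Bq.
rewrite h1 (asboolT Qq) asboolF; last by move/(PQ0 Pp).
by case: (s q).
Qed.

End plane_cover.

End plane.

(** * Geometry of penny packings *)

Lemma near_all (T : topologicalType) (I : eqType) (P : I -> set T) (z : T) (s : seq I) :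
  (forall i, i \in s -> nbhs z (P i)) ->
  \forall y \near z, forall i, i \in s -> P i y.
Proof.
elim: s => [_|a s IH h]; first exact: nearW.
have := h a (mem_head _ _).
apply: filterS2 (IH (fun i si => h i (mem_behead (s := a :: s) si))) => y h1 h2 i.
by rewrite inE => /orP[/eqP->//|]; exact: h1.
Qed.

Lemma finite_set_bounded (T : choiceType) (A : set T) (n : nat) :
  (forall s, uniq s -> {in s, forall x, A x} -> (size s <= n)%N) -> finite_set A.
Proof.
move=> h; apply: contrapT => /(infinite_set_fset n.+1) [B BA nB].
have := h B (fset_uniq B) (fun x xB => BA x xB).
by rewrite leqNgt nB.
Qed.

Section plane.
Variable R : realType.
Local Notation T := (R * R)%type.
Implicit Types (p q z y : T).

Definition dist2 p q : R := (p.1 - q.1) ^+ 2 + (p.2 - q.2) ^+ 2.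

Lemma dist2C p q : dist2 p q = dist2 q p.
Proof. by rewrite /dist2; ring. Qed.

(* Stewart's identity: expand the second moment of a random point of [p, q]
   about an independent random point of [p', q']. *)
Lemma dist2_barycenter p q p' q' (t s : R) :
  (1 - t) * (1 - s) * dist2 p p' + (1 - t) * s * dist2 p q' +
    t * (1 - s) * dist2 q p' + t * s * dist2 q q' =
  t * (1 - t) * dist2 p q + s * (1 - s) * dist2 p' q' +
    dist2 ((1 - t) * p.1 + t * q.1, (1 - t) * p.2 + t * q.2)
          ((1 - s) * p'.1 + s * q'.1, (1 - s) * p'.2 + s * q'.2).
Proof. by rewrite /dist2 /=; ring. Qed.

(** In [dist2_barycenter] the four weights on the left sum to 1, so the left side is at least 1,
    while each segment contributes at most [1 / 4] on the right. *)
Lemma segments_apart p q p' q' z y :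
  dist2 p q <= 1 -> dist2 p' q' <= 1 ->
  1 <= dist2 p p' -> 1 <= dist2 p q' -> 1 <= dist2 q p' -> 1 <= dist2 q q' ->
  segment p q z -> segment p' q' y -> 1 / 2 <= dist2 z y.
Proof.
move=> pq pq' h1 h2 h3 h4 [t /=]; rewrite in_itv /= => /andP[t0 t1] <-.
move=> [s /=]; rewrite in_itv /= => /andP[s0 s1] <-.
have := dist2_barycenter p q p' q' t s.
set d := dist2 (_, _) (_, _); move: (dist2 p q) (dist2 p' q') (dist2 p p')
  (dist2 p q') (dist2 q p') (dist2 q q') pq pq' h1 h2 h3 h4.
move=> a b e f g h a1 b1 e1 f1 g1 h1 E.
have t1' : 0 <= 1 - t by lra. have s1' : 0 <= 1 - s by lra.
have w1 : 0 <= (1 - t) * (1 - s) * (e - 1) by rewrite !mulr_ge0//; lra.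
have w2 : 0 <= (1 - t) * s * (f - 1) by rewrite !mulr_ge0//; lra.
have w3 : 0 <= t * (1 - s) * (g - 1) by rewrite !mulr_ge0//; lra.
have w4 : 0 <= t * s * (h - 1) by rewrite !mulr_ge0//; lra.
have w5 : 0 <= t * (1 - t) * (1 - a) by rewrite !mulr_ge0//; lra.
have w6 : 0 <= s * (1 - s) * (1 - b) by rewrite !mulr_ge0//; lra.
have w7 := sqr_ge0 (t - 1 / 2). have w8 := sqr_ge0 (s - 1 / 2).
nra.
Qed.

(** Two unit segments from [p] with ends at least 1 apart make an angle of at least 60 degrees,
    whence the squared sine [3 / 4]. The value 0 is allowed for [dist2 p q'] so that degenerate
    links are covered. *)
Lemma segments_common_end p q q' (t : R) y :
  dist2 p q = 1 -> dist2 p q' = 0 \/ dist2 p q' = 1 -> 1 <= dist2 q q' -> 0 <= t <= 1 ->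
  segment p q' y ->
  3 / 4 * t ^+ 2 <= dist2 ((1 - t) * p.1 + t * q.1, (1 - t) * p.2 + t * q.2) y.
Proof.
move=> pq pq' qq' /andP[t0 t1] [s /=]; rewrite in_itv /= => /andP[s0 s1] <-.
have := dist2_barycenter p q p q' t s.
set d := dist2 (_, _) (_, _); rewrite (dist2C q p) pq {1}/dist2 !subrr expr0n /= addr0.
move: (dist2 p q') (dist2 q q') pq' qq' => a b a01 b1 E.
have w : 0 <= t * s * (b - 1) by rewrite !mulr_ge0//; lra.
have w7 := sqr_ge0 (s - t / 2). have w8 := sqr_ge0 t.
case: a01 => a01; rewrite a01 in E; nra.
Qed.

Section packing.
Variables (c : nat -> T) (pc : penny_packing c).

Lemma packing_dist2 i j : i != j -> 1 <= dist2 (c i) (c j).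
Proof.
move=> /eqP ij; rewrite leNgt; apply/negP => h; apply: ij; apply: pc => //.
exists (((c i).1 + (c j).1) / 2, ((c i).2 + (c j).2) / 2).
have s4 : Num.sqrt ((1 / 2) ^+ 2) = 1 / 2 :> R by rewrite sqrtr_sqr ger0_norm//; lra.
move: h; rewrite /dist2 => h.
by split; rewrite /open_disk /euclid_dist /= -s4 ltr_sqrt; nra.
Qed.

Lemma adj_dist2 i j : adj c i j -> dist2 (c i) (c j) = 1.
Proof.
move=> /andP[_ /eqP /(congr1 (fun x => x ^+ 2))]; rewrite expr1n /euclid_dist.
by rewrite sqr_sqrtr// addr_ge0 ?sqr_ge0.
Qed.

(** Allowing the degenerate segment at a vertex makes the embedded image a union of link segments,
    without a separate case for vertices. *)
Definition link : rel nat := fun i j => (i == j) || adj c i j.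

Lemma link_sym : symmetric link.
Proof. by move=> i j; rewrite /link eq_sym adj_sym. Qed.

Lemma link_dist2 i j : link i j -> dist2 (c i) (c j) = 0 \/ dist2 (c i) (c j) = 1.
Proof.
move=> /orP[/eqP->|/adj_dist2]; last by right.
by left; rewrite /dist2 !subrr expr0n addr0.
Qed.

Lemma link_dist2_le i j : link i j -> dist2 (c i) (c j) <= 1.
Proof. by move=> /link_dist2[]->. Qed.

Local Notation G := (embedded_image c).

Lemma embedded_imageP z : G z <-> exists i j, link i j /\ segment (c i) (c j) z.
Proof.
split=> [[[i _ <-]|[[i j] /= ij zij]]|[i [j [/orP[/eqP->|ij] zij]]]].
- by exists i, i; split; [rewrite /link eqxx|exact: segment_left].
- by exists i, j; split => //; rewrite /link ij orbT.
- left; exists j => //; case: zij => t _ <-.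
  by case: (c j) => a b /=; congr pair; ring.
- by right; exists (i, j).
Qed.

Lemma link_segments_apart i j k l z y : link i j -> link k l ->
  [&& i != k, i != l, j != k & j != l] ->
  segment (c i) (c j) z -> segment (c k) (c l) y -> 1 / 2 <= dist2 z y.
Proof.
move=> ij kl /and4P[ik il jk jl]; apply: segments_apart;
  by [exact: link_dist2_le|exact: packing_dist2].
Qed.

(** A link sharing one end with the edge is too far by [segments_common_end]. A link sharing none is
    at squared distance at least [1 / 2], which exceeds [3 / 4 * t0 ^+ 2] because [t0 <= 1 / 2]. *)
Lemma near_edge i j (t t0 : R) g : adj c i j -> 0 < t0 -> t0 <= t <= 1 - t0 -> G g ->
  dist2 ((1 - t) * (c i).1 + t * (c j).1, (1 - t) * (c i).2 + t * (c j).2) g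
    < 3 / 4 * t0 ^+ 2 ->
  segment (c i) (c j) g.
Proof.
move=> ij t00 /andP[tl tr] /embedded_imageP[k [l [kl gkl]]] dg.
have t01 : 0 <= t <= 1 by apply/andP; split; lra.
pose z : T := ((1 - t) * (c i).1 + t * (c j).1, (1 - t) * (c i).2 + t * (c j).2).
have zij : segment (c i) (c j) z by exists t => //; rewrite /= in_itv.
have share k' l' : link k' l' -> segment (c k') (c l') g ->
    (k' == i) || (k' == j) -> (l' == i) || (l' == j).
  move=> kl' gkl' k'ij; apply/negPn/negP; rewrite negb_or => /andP[li lj].
  move: k'ij => /orP[] /eqP k'E; rewrite {}k'E in kl' gkl'.
    have := segments_common_end (adj_dist2 ij) (link_dist2 kl')
      (packing_dist2 _) t01 gkl'; rewrite eq_sym => /(_ lj); nra.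
  have t01' : 0 <= 1 - t <= 1 by apply/andP; split; lra.
  have ji : adj c j i by rewrite adj_sym.
  have := segments_common_end (adj_dist2 ji) (link_dist2 kl')
    (packing_dist2 _) t01' gkl'; rewrite eq_sym => /(_ li).
  rewrite subKr [X in dist2 (X, _)]addrC [X in dist2 (_, X)]addrC; nra.
have [kij|kij] := boolP ((k == i) || (k == j)).
  have lij := share _ _ kl gkl kij; move: kij lij gkl => {share kl}.
  move=> /orP[] /eqP-> /orP[] /eqP-> => //.
  - case=> u _ <-; exists 0; first by rewrite /= in_itv /= lexx ler01.
    by congr pair; ring.
  - exact: segmentC.
  - case=> u _ <-; exists 1; first by rewrite /= in_itv /= lexx ler01.
    by congr pair; ring.
have [lij|lij] := boolP ((l == i) || (l == j)).
  have := share l k; rewrite link_sym => /(_ kl (segmentC gkl) lij).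
  by rewrite (negbTE kij).
move: kij lij; rewrite !negb_or => /andP[ki kj] /andP[li lj].
have : 1 / 2 <= dist2 z g.
  apply: (link_segments_apart _ kl _ zij gkl); first by rewrite /link ij orbT.
  by rewrite ![_ == k]eq_sym ![_ == l]eq_sym ki kj li lj.
rewrite /z; nra.
Qed.

(** Cut the rectangle into squares of side [1 / 2]: two centers in one square would be at squared
    distance below [1 / 2]. *)
Lemma packing_count (a b d e : R) (s : seq nat) : a <= b -> d <= e ->
  uniq s -> {in s, forall i, a <= (c i).1 <= b /\ d <= (c i).2 <= e} ->
  (size s)%:R <= (2 * (b - a) + 1) * (2 * (e - d) + 1).
Proof.
move=> ab de us sP.
pose f i := (Num.truncn (2 * ((c i).1 - a)), Num.truncn (2 * ((c i).2 - d))).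
pose n := (Num.truncn (2 * (b - a))).+1; pose m := (Num.truncn (2 * (e - d))).+1.
have trunc (x : R) : 0 <= x -> x - 1 < (Num.truncn x)%:R <= x.
  by move=> /truncn_itv; rewrite -natr1 => /andP[? ?]; apply/andP; split; lra.
have finj : {in s &, injective f}.
  move=> i j si sj [e1 e2]; apply/eqP/negPn/negP => /packing_dist2.
  have [/andP[i1 _] /andP[i2 _]] := sP _ si; have [/andP[j1 _] /andP[j2 _]] := sP _ sj.
  have := @trunc (2 * ((c i).1 - a)); have := @trunc (2 * ((c j).1 - a)).
  have := @trunc (2 * ((c i).2 - d)); have := @trunc (2 * ((c j).2 - d)).
  rewrite e1 e2 => h4 h3 h2 h1.
  have /andP[? ?] := h1 ltac:(lra); have /andP[? ?] := h2 ltac:(lra).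
  have /andP[? ?] := h3 ltac:(lra); have /andP[? ?] := h4 ltac:(lra).
  have sq (x y : R) : -1 < 2 * (x - y) < 1 -> (x - y) ^+ 2 < 1 / 4.
    by move=> /andP[? ?]; nra.
  have := @sq (c i).1 (c j).1; have := @sq (c i).2 (c j).2.
  rewrite /dist2 => g2 g1.
  have := g1 ltac:(apply/andP; split; lra); have := g2 ltac:(apply/andP; split; lra); lra.
have le_iota (x y z : R) : x <= y <= z ->
    Num.truncn (2 * (y - x)) \in iota 0 (Num.truncn (2 * (z - x))).+1.
  move=> /andP[xy yz]; rewrite mem_iota /= add0n ltnS; apply: le_truncn; lra.
have snm : (size s <= n * m)%N.
  rewrite -(size_map f) -(size_iota 0 n) -{1}(size_iota 0 m) -(size_allpairs pair).
  apply: uniq_leq_size; first by rewrite map_inj_in_uniq.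
  move=> _ /mapP[i si ->]; have [h1 h2] := sP _ si.
  by apply/allpairsP; exists (f i); split; [exact: le_iota|exact: le_iota|].
apply: (@le_trans _ _ (n * m)%:R); first by rewrite ler_nat.
have leb (x y : R) : x <= y -> (Num.truncn (2 * (y - x))).+1%:R <= 2 * (y - x) + 1.
  by move=> xy; rewrite -natr1 lerD2r; have /andP[] := @trunc (2 * (y - x)) ltac:(lra).
by rewrite natrM; apply: ler_pM; rewrite ?ler0n//; exact: leb.
Qed.

Lemma packing_finite (z : T) (r : R) :
  finite_set [set i | `|(c i).1 - z.1| <= r /\ `|(c i).2 - z.2| <= r].
Proof.
have [r0|r0] := leP 0 r; last first.
  apply: (sub_finite_set _ (finite_set0 _)) => i [h _].
  by move: (le_lt_trans h r0); rewrite ltNge normr_ge0.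
apply: (@finite_set_bounded _ _ (Num.bound ((4 * r + 1) ^+ 2))) => s us sP.
rewrite -(ler_nat R); apply/ltW; apply: le_lt_trans (unstable.ltr_bound _).
have := @packing_count (z.1 - r) (z.1 + r) (z.2 - r) (z.2 + r) s.
have -> : 2 * (z.1 + r - (z.1 - r)) + 1 = 4 * r + 1 by ring.
have -> : 2 * (z.2 + r - (z.2 - r)) + 1 = 4 * r + 1 by ring.
rewrite -expr2; apply=> //; try lra.
move=> i /sP[]; rewrite !ler_norml => /andP[? ?] /andP[? ?].
by split; apply/andP; split; lra.
Qed.

(** Only finitely many links come near [z], and each segment is closed, so a small square avoids
    those that miss [z]. Radius 2 suffices in the count: the ends of a link are within 1 of its
    points, and these are within 1 of [z]. *)
Lemma segments_near (z : T) : exists2 e, 0 < e & forall y, ball z e y ->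
  forall i j, link i j -> segment (c i) (c j) y -> segment (c i) (c j) z.
Proof.
have fin := packing_finite z 2.
pose F := fset_set [set i | `|(c i).1 - z.1| <= 2 /\ `|(c i).2 - z.2| <= 2].
have : \forall y \near z, forall e : nat * nat, e \in [seq (i, j) | i <- F, j <- F] ->
    segment (c e.1) (c e.2) y -> segment (c e.1) (c e.2) z.
  apply: near_all => e _.
  have [h|h] := pselect (segment (c e.1) (c e.2) z); first by apply: filterS (@filterT _ (nbhs z) _) => y _.
  have : nbhs z (~` segment (c e.1) (c e.2)).
    by apply: open_nbhs_nbhs; split=> //; apply: closed_openC; exact: closed_segment.
  by apply: filterS => y ny /ny.
move=> /nbhs_ballP[e /= e0 eP]; exists (Num.min e 1); first by rewrite lt_min ltr01 andbT.
move=> y zy i j ij yij.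
have zye : ball z e y by apply: le_ball zy; rewrite ge_min lexx.
have zy1 : ball z 1 y by apply: le_ball zy; rewrite ge_min lexx orbT.
have inF k l : link k l -> segment (c k) (c l) y -> k \in F.
  move=> kl [t /=]; rewrite in_itv /= => /andP[t0 t1] ykl.
  rewrite in_fset_set//; apply/mem_set => /=.
  move: zy1; rewrite ball_planeE -ykl /= !ltr_norml => -[/andP[h1 h2] /andP[h3 h4]].
  have kl1 := link_dist2_le kl.
  have sq (u v : R) : u ^+ 2 + v ^+ 2 <= 1 -> (u <= 1 /\ -1 <= u) /\ (v <= 1 /\ -1 <= v).
    by move=> h; split; split; nra.
  have [[? ?] [? ?]] := sq _ _ kl1.
  by rewrite !ler_norml; split; apply/andP; split; nra.
apply: (eP _ zye (i, j)) => //; apply/allpairsP; exists (i, j); split=> //=.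
  exact: (inF i j).
by apply: (inF j i); [rewrite link_sym|exact: segmentC].
Qed.

Lemma closed_image : closed G.
Proof.
move=> z; have [e e0 eP] := segments_near z.
move=> /(_ _ (nbhsx_ballx z e e0)) [y [/embedded_imageP[i [j [ij yij]]] zy]].
by apply/embedded_imageP; exists i, j; split=> //; exact: (eP y).
Qed.

End packing.
End plane.

(** * Faces *)

(** The set is a union of four open half-planes, each convex, and added in an order in which each
    meets the union of the previous ones. In [H e k], [e] is the sign and [k] selects the
    coordinate. *)
Lemma connected_outside_square (R : realType) (z : R * R) (r : R) :
  connected [set y : R * R | r < `|y.1 - z.1| \/ r < `|y.2 - z.2|].
Proof.
pose H (e : bool) (k : bool) : set (R * R) :=
  [set y | r < (-1) ^+ e * (if k then y.1 - z.1 else y.2 - z.2)].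
have cH e k : connected (H e k).
  have [[p Hp]|/nonemptyPn ->] := pselect (H e k !=set0); last exact: connected0.
  apply: (@star_connected _ _ p) => q Hq w [t /=]; rewrite in_itv /= => /andP[t0 t1] <-.
  have t01 : 0 <= t <= 1 by rewrite t0.
  pose f y := (-1) ^+ e * (if k then y.1 - z.1 else y.2 - z.2).
  have := @convex_lt _ (- f p) (- f q) (- r) t t01.
  rewrite !ltrN2 => /(_ Hp Hq).
  by rewrite /H /f /=; case: (k) => h /=; lra.
rewrite (_ : [set y | _] = ((H false true `|` H false false) `|` H true true) `|` H true false).
  pose a := `|r| + 1.
  have ra : r < a by rewrite /a; have := ler_norm r; lra.
  apply: connectedU => //.
    by exists (z.1 + a, z.2 - a); split; [left; left|]; rewrite /H /= ?expr0 ?expr1; lra.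
  apply: connectedU => //.
    by exists (z.1 - a, z.2 + a); split; [right|]; rewrite /H /= ?expr0 ?expr1; lra.
  apply: connectedU => //.
  by exists (z.1 + a, z.2 + a); split; rewrite /H /= ?expr0 ?expr1; lra.
apply/seteqP; split=> y; rewrite /H /= !expr0 !expr1 !mul1r !mulN1r !ltr_normr.
  by move=> [|] /orP[]; tauto.
by move=> [[[|]|]|] ->; rewrite ?orbT; by [left|right].
Qed.

Section penny_graph.
Variables (R : realType) (D : nat) (c : nat -> R * R).
Local Notation T := (R * R)%type.
Implicit Types (p q z y : T) (U : set T).
Local Notation G := (embedded_image c).
Hypotheses (pc : penny_packing c) (cG : graph_connected (adj c)).

(** A connected graph on infinitely many vertices has no isolated vertex, so a degenerate link can
    be replaced by an edge. *)
Lemma image_adjP z : G z -> exists i j, adj c i j /\ segment (c i) (c j) z.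
Proof.
move=> /embedded_imageP[i [j [/orP[/eqP->|ij] zij]]]; last by exists i, j.
have [p pp lp] := cG j j.+1; case: p pp lp => [_ /= /esym/eqP|k p /= /andP[jk _] _].
  by rewrite eqn_leq ltnn.
exists j, k; split=> //.
suff -> : z = c j by exact: segment_left.
case: zij => t _ <-; case: (c j) => a b /=; congr pair; ring.
Qed.

Lemma image_vertex i : G (c i).
Proof. by left; exists i. Qed.

Lemma link_segment_image i j : link c i j -> segment (c i) (c j) `<=` G.
Proof. by move=> ij z zij; apply/embedded_imageP; exists i, j. Qed.

Lemma connected_image : connected G.
Proof.
apply: locally_constant_connected => s sG.
have edge i j z : link c i j -> segment (c i) (c j) z -> s (c i) = s z.
  move=> ij zij; apply: (connected_locally_constant (@connected_segment _ (c i) (c j)) (s := s)).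
  - by apply: locally_constant_subset sG; exact: link_segment_image.
  - exact: segment_left.
  - exact: zij.
have vertex i j : s (c i) = s (c j).
  have [p + <-] := cG i j; elim: p i => //= k p IH i /andP[ik kp].
  rewrite -(IH k kp); apply: edge (segment_right _ _).
  by rewrite /link ik orbT.
move=> x y /embedded_imageP[i [j [ij /(edge _ _ _ ij) <-]]] /embedded_imageP[k [l [kl /(edge _ _ _ kl) <-]]].
exact: vertex.
Qed.

Lemma face_component U z : faces c U -> U z -> U = connected_component (~` G) z.
Proof. by move=> [p _ <-]; exact: same_connected_component. Qed.

Lemma open_face U : faces c U -> open U.
Proof.
move=> [p _ <-]; apply: open_component; apply: closed_openC; exact: closed_image.
Qed.

Lemma connected_face U : faces c U -> connected U.
Proof. by move=> [p _ <-]; exact: component_connected. Qed.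

Lemma face_nonempty U : faces c U -> U !=set0.
Proof. by move=> [p Gp <-]; exists p; exact: connected_component_refl. Qed.

Lemma face_image U z : faces c U -> U z -> ~ G z.
Proof. by move=> [p _ <-]; exact: connected_component_sub. Qed.

Lemma face_boundary U z : faces c U -> closure U z -> ~ U z -> G z.
Proof.
move=> [p _ <-] cz; apply: contra_notP => nG.
by apply: component_boundary => //; apply: closed_openC; exact: closed_image.
Qed.

Lemma exists_face z : ~ G z -> exists2 U, faces c U & U z.
Proof.
move=> nG; exists (connected_component (~` G) z); first by exists z.
exact: connected_component_refl.
Qed.

Lemma faces_eq U U' z : faces c U -> faces c U' -> U z -> U' z -> U = U'.
Proof. by move=> fU fU' Uz U'z; rewrite (face_component fU Uz) (face_component fU' U'z). Qed.

Lemma face_exit U L : faces c U -> connected L -> L `&` U !=set0 -> L `&` ~` U !=set0 ->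
  exists z, [/\ L z, closure U z & G z].
Proof.
move=> fU cL LU [y [Ly nUy]]; apply: contrapT => h; apply: nUy.
apply: (connected_sub_open (open_face fU) cL LU) => // z [Lz cz].
apply: contrapT => nUz; apply: h; exists z; split=> //; exact: face_boundary nUz.
Qed.

(** The complement consists of the connected image and the other faces. The closure of such a face
    [W] misses [U] and meets the image, at an exit point of a segment from [W] to a vertex. *)
Lemma connected_face_complement U : faces c U -> connected (~` U).
Proof.
move=> fU; apply: locally_constant_connected => s sU.
have GU : G `<=` ~` U by move=> z Gz Uz; exact: (face_image fU Uz).
have sG y z : G y -> G z -> s y = s z.
  apply: (connected_locally_constant connected_image (s := s)).
  exact: locally_constant_subset sU.
have toG y : ~ U y -> exists2 z, G z & s y = s z.
  move=> nUy; have [Gy|nGy] := pselect (G y); first by exists y.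
  have [W fW Wy] := exists_face nGy.
  have WU z : closure W z -> ~ U z.
    move=> cWz Uz; have [w [Ww Uw]] := cWz _ (open_nbhs_nbhs (conj (open_face fU) Uz)).
    by apply: nUy; rewrite (faces_eq fU fW Uw Ww).
  have [] := @face_exit W (segment y (c 0%N)) fW (@connected_segment _ _ _).
  - by exists y; split=> //; exact: segment_left.
  - exists (c 0%N); split; first exact: segment_right.
    by move=> W0; apply: (face_image fW W0); exact: image_vertex.
  move=> z [_ cz Gz]; exists z => //.
  apply: (connected_locally_constant (connected_closure (connected_face fW)) (s := s)) => //.
    by apply: locally_constant_subset sU => w /WU.
  exact: subset_closure.
move=> x y /toG[x' Gx' ->] /toG[y' Gy' ->]; exact: sG.
Qed.

Definition face_vertices U : set nat := [set i | closure U (c i)].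

Let pt i j (t : R) : T := ((1 - t) * (c i).1 + t * (c j).1, (1 - t) * (c i).2 + t * (c j).2).

Lemma dist2_lt (x y : T) (e : R) : 0 < e -> ball x e y -> dist2 x y < 2 * e ^+ 2.
Proof.
move=> e0; rewrite ball_planeE !ltr_norml /dist2 => -[/andP[? ?] /andP[? ?]].
nra.
Qed.

(* A point of the face close to the edge stays in the face when translated
   parallel to the edge, since no other edge comes close. *)
Lemma face_slide U i j (t t' : R) : faces c U -> adj c i j -> 0 < t < 1 -> 0 < t' < 1 ->
  closure U (pt i j t) -> closure U (pt i j t').
Proof.
move=> fU ij /andP[t0 t1] /andP[t0' t1'] ct.
pose d := Num.min (Num.min t t') (Num.min (1 - t) (1 - t')).
have d0 : 0 < d by rewrite /d !lt_min t0 t0' !subr_gt0 t1 t1'.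
have [dt dt' d1t d1t'] : [/\ d <= t, d <= t', d <= 1 - t & d <= 1 - t'].
  by rewrite /d; split; rewrite !ge_min lexx ?orbT.
have uij := adj_dist2 ij.
move=> B /nbhs_ballP[e /= e0 eB].
(* With [e' <= d / 2], points in the square of half-side [e'] have squared distance below
   [d ^+ 2 / 2], hence below the bound [3 / 4 * d ^+ 2] of [near_edge]. *)
pose e' := Num.min e (d / 2).
have e'0 : 0 < e' by rewrite /e' lt_min e0 divr_gt0.
have [p [Up tp]] := ct _ (nbhsx_ballx (pt i j t) e' e'0).
have e'd : e' <= d / 2 by rewrite /e' ge_min lexx orbT.
pose v : T := ((c j).1 - (c i).1, (c j).2 - (c i).2).
pose sh (u : R) : T := (p.1 + (u - t) * v.1, p.2 + (u - t) * v.2).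
have ball_sh u : ball (pt i j u) e' (sh u).
  move: tp; rewrite !ball_planeE /pt /sh /v /=.
  by congr (_ /\ _); congr (`| _ | < _); ring.
have nGsh u : d <= u <= 1 - d -> ~ G (sh u).
  move=> /andP[du du1] Gs.
  have : segment (c i) (c j) (sh u).
    apply: (near_edge pc ij d0 _ Gs (t := u)); first by rewrite du.
    have := dist2_lt e'0 (ball_sh u); rewrite /pt => /lt_le_trans; apply.
    have := mulr_ge0 (ltW d0) (ltW d0); nra.
  (* If the translated point lay on the edge, then [p] would lie on the same line, at a parameter
     within [d] of [t], hence on the edge itself, although it belongs to the face. *)
  move=> [w _ [h1 h2]].
  have p1 : p = pt i j (w - u + t).
    move: h1 h2; rewrite /sh /v /pt /= => h1 h2.
    by rewrite [p]surjective_pairing; congr pair; lra.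
  have := dist2_lt e'0 tp; rewrite {1}p1.
  have -> : dist2 (pt i j t) (pt i j (w - u + t)) = (w - u) ^+ 2 * dist2 (c i) (c j).
    by rewrite /dist2 /pt /=; ring.
  rewrite uij mulr1 => wu.
  have {}wu : (w - u) ^+ 2 < d ^+ 2.
    apply: (lt_le_trans wu); have := mulr_ge0 (ltW d0) (ltW d0); nra.
  have : - d < w - u < d by rewrite -ltr_norml -(ltr_pXn2r (n := 2)) ?nnegrE ?real_normK ?num_real// ltW.
  move=> /andP[? ?].
  apply: (face_image fU Up); apply: (@link_segment_image i j); first by rewrite /link ij orbT.
  by rewrite p1; exists (w - u + t) => //; rewrite /= in_itv /=; apply/andP; split; lra.
exists (sh t'); split; last first.
  by apply: eB; apply: le_ball (ball_sh t'); rewrite /e' ge_min lexx.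
have pE : p = sh t by rewrite /sh subrr !mul0r !addr0; case: (p).
rewrite (face_component fU Up).
exists (segment (sh t) (sh t')); last exact: segment_right.
split; [by rewrite {1}pE; exact: segment_left| |exact: connected_segment].
move=> y [u /=]; rewrite in_itv /= => /andP[u0 u1] <-.
rewrite (_ : (_, _) = sh ((1 - u) * t + u * t')).
  by apply: nGsh; apply/andP; split; nra.
by rewrite /sh /=; congr pair; ring.
Qed.

(** Sliding towards parameter 0 brings points of the closure arbitrarily close to [c i]. *)
Lemma face_edge_end U i j (t : R) : faces c U -> adj c i j -> 0 < t < 1 ->
  closure U (pt i j t) -> face_vertices U i.
Proof.
move=> fU ij t01 ct B /nbhs_ballP[e /= e0 eB].
set e' := Num.min (1 / 2) (e / 2).
have e'0 : 0 < e' by rewrite /e' lt_min !divr_gt0.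
have [e'1 e'2] : e' <= 1 / 2 /\ e' <= e / 2 by rewrite /e' !ge_min !lexx orbT.
have e'01 : 0 < e' < 1 by apply/andP; split; lra.
have e20 : 0 < e / 2 by rewrite divr_gt0.
have [w [Uw ew]] := face_slide fU ij t01 e'01 ct (nbhsx_ballx (pt i j e') (e / 2) e20).
exists w; split=> //; apply: eB; move: ew.
have := adj_dist2 ij; rewrite /dist2 => d1.
have sq (u v : R) : u ^+ 2 + v ^+ 2 = 1 -> [/\ -1 <= u, u <= 1, -1 <= v & v <= 1].
  by move=> h; split; nra.
have [? ? ? ?] := sq _ _ d1.
rewrite !ball_planeE /pt /= !ltr_norml => -[/andP[h1 h2] /andP[h3 h4]].
have b (x : R) : -1 <= x <= 1 -> - (e / 2) <= e' * x <= e / 2.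
  by move=> /andP[? ?]; apply/andP; split; nra.
have /andP[? ?] := b ((c i).1 - (c j).1) ltac:(apply/andP; split; lra).
have /andP[? ?] := b ((c i).2 - (c j).2) ltac:(apply/andP; split; lra).
by split; apply/andP; split; lra.
Qed.

(** The link may be degenerate: when [z] is itself a vertex, no neighbour of it need lie in the
    closure of [U]. *)
Lemma face_boundary_link U z : faces c U -> closure U z -> ~ U z ->
  exists i j, [/\ link c i j, face_vertices U i, face_vertices U j & segment (c i) (c j) z].
Proof.
move=> fU cz nUz; have [i [j [ij [t /=]]]] := image_adjP (face_boundary fU cz nUz).
rewrite in_itv /= => /andP[t0 t1] zE.
have lk k : closure U (c k) -> z = c k -> exists i j,
    [/\ link c i j, face_vertices U i, face_vertices U j & segment (c i) (c j) z].
  by move=> ck ->; exists k, k; split=> //; [rewrite /link eqxx|exact: segment_left].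
have pE k (a b : R) : a = 1 -> b = 0 -> forall l, (a * (c k).1 + b * (c l).1, a * (c k).2 + b * (c l).2) = c k.
  by move=> -> -> l; rewrite !mul0r !addr0 !mul1r; case: (c k).
have [t0E|nt0] := eqVneq t 0.
  have zi : z = c i by rewrite -zE t0E pE ?subr0.
  by apply: (lk i) => //; rewrite -zi.
have [t1E|nt1] := eqVneq t 1.
  have zi : z = c j by rewrite -zE t1E subrr !mul0r !add0r !mul1r; case: (c j).
  by apply: (lk j) => //; rewrite -zi.
have t01 : 0 < t < 1 by rewrite !lt_neqAle eq_sym nt0 t0 nt1.
have t01' : 0 < 1 - t < 1 by move: t01 => /andP[? ?]; apply/andP; split; lra.
exists i, j; split; first by rewrite /link ij orbT.
- by apply: (face_edge_end fU ij t01); rewrite /pt zE.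
- apply: (face_edge_end fU _ t01'); first by rewrite adj_sym; exact: ij.
  by rewrite /pt subKr addrC [X in (_, X)]addrC zE.
- by exists t => //; rewrite /= in_itv /= t0.
Qed.

Hypothesis hD : (ereal_sup [set facial_degree c U | U in faces c] <= D%:R%:E)%E.

(** Choosing one corner of [U] at each of its vertices is injective, as a corner records its vertex.
    The bound [D] rules out the value [+oo] of [counting]. *)
Lemma face_vertices_size U s : faces c U -> uniq s ->
  {in s, forall i, face_vertices U i} -> (size s <= D)%N.
Proof.
move=> fU us sU.
have ex i : exists S, face_vertices U i -> corners c U (i, S).
  have [Vi|nVi] := pselect (face_vertices U i); last by exists set0 => /nVi.
  have [p [Up ip]] : U `&` open_disk (c i) (1 / 2) !=set0.
    (* The square of half-side [1 / 4] lies inside the disk of radius [1 / 2]. *)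
    have [p [Up ip]] := Vi _ (nbhsx_ballx (c i) (1 / 4) ltac:(lra)).
    exists p; split=> //; rewrite /open_disk /euclid_dist /=.
    have s4 : Num.sqrt ((1 / 2) ^+ 2) = 1 / 2 :> R by rewrite sqrtr_sqr ger0_norm//; lra.
    have := @dist2_lt _ _ (1 / 4) ltac:(lra) ip.
    by rewrite -s4 ltr_sqrt /dist2; lra.
  by exists (connected_component (U `&` open_disk (c i) (1 / 2)) p) => _; exists p.
have /choice[f fP] := ex.
have : (facial_degree c U <= D%:R%:E)%E.
  by apply: le_trans hD; apply: ereal_sup_ubound; exists U.
rewrite /facial_degree /counting; case: asboolP => // fin.
rewrite lee_fin ler_nat; apply: leq_trans.
rewrite -(size_map (fun i => (i, f i))).
apply: uniq_leq_size; first by rewrite map_inj_uniq// => i j [].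
move=> _ /mapP[i si ->]; rewrite in_fset_set//; apply/mem_set; apply: fP.
exact: sU.
Qed.

End penny_graph.

(** * Coarse connectedness *)

Section joined.
Variables (V : eqType) (e : rel V).
Hypothesis e_sym : symmetric e.
Implicit Types (A B : set V) (u v w : V).

Definition joined A u v :=
  exists p, [/\ path e u p, last u p = v & {in u :: p, forall i, A i}].

Lemma joined_refl A u : A u -> joined A u u.
Proof. by move=> Au; exists [::]; split=> // i; rewrite inE => /eqP->. Qed.

Lemma joined_trans A u v w : joined A u v -> joined A v w -> joined A u w.
Proof.
move=> [p [pp lp pA]] [q [qq lq qA]]; exists (p ++ q).
rewrite cat_path last_cat lp pp qq lq; split=> // i.
rewrite inE mem_cat orbA -in_cons => /orP[/pA//|iq].
by apply: qA; rewrite inE iq orbT.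
Qed.

Lemma joined_edge A u v : A u -> A v -> e u v -> joined A u v.
Proof.
move=> Au Av uv; exists [:: v]; split=> //=; first by rewrite uv.
by move=> i; rewrite !inE => /orP[]/eqP->.
Qed.

Lemma joined_sym A u v : joined A u v -> joined A v u.
Proof.
move=> [p [+ <- +]]; elim: p u => /= [u _ uA|w p IH u /andP[uw wp] pA].
  by apply: joined_refl; apply: uA; rewrite mem_head.
have Ai i : i \in w :: p -> A i by move=> ip; apply: pA; rewrite inE ip orbT.
apply: (joined_trans (IH w wp Ai)); apply: joined_edge; last by rewrite e_sym.
  by apply: Ai; rewrite mem_head.
by apply: pA; rewrite mem_head.
Qed.

Lemma joined_subset A B u v : A `<=` B -> joined A u v -> joined B u v.
Proof. by move=> AB [p [pp lp pA]]; exists p; split=> // i /pA /AB. Qed.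

Lemma joined_uniq A u v : joined A u v ->
  exists p, [/\ path e u p, last u p = v, uniq (u :: p) & {in u :: p, forall i, A i}].
Proof.
move=> [p [pp lp pA]]; case: (shortenP pp) lp => q qq uq qp lq.
exists q; split=> // i; rewrite inE => /orP[/eqP->|/qp ip].
  by apply: pA; rewrite mem_head.
by apply: pA; rewrite inE ip orbT.
Qed.

End joined.

Section penny_graph.
Variables (R : realType) (D : nat) (c : nat -> R * R).
Local Notation T := (R * R)%type.
Implicit Types (z y : T) (U : set T).
Local Notation G := (embedded_image c).
Hypotheses (pc : penny_packing c) (cG : graph_connected (adj c)).
Hypothesis hD : (ereal_sup [set facial_degree c U | U in faces c] <= D%:R%:E)%E.

(* If [S] split the boundary in two, thin neighbourhoods of the two parts would
   contradict unicoherence, as both [U] and its complement are connected. *)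
Lemma face_vertices_closed U (S : set nat) v w : faces c U ->
  (forall i j, S i -> face_vertices c U i -> face_vertices c U j -> adj c i j -> S j) ->
  S v -> face_vertices c U v -> face_vertices c U w -> S w.
Proof.
move=> fU Sadj Sv Uv Uw; apply: contrapT => nSw.
pose F (S' : set nat) := [set y | exists i j, [/\ link c i j,
   face_vertices c U i /\ S' i, face_vertices c U j /\ S' j & segment (c i) (c j) y]].
pose O S' := \bigcup_(y in F S') ball y (1 / 4).
have oO S' : open (O S') by apply: bigcup_open => y _; apply: ball_open; lra.
have FO S' : F S' `<=` O S' by move=> y Fy; exists y => //; apply: ballxx; lra.
have nUF S' y : F S' y -> ~ U y.
  move=> [i [j [ij _ _ yij]]] Uy; apply: (face_image fU Uy).
  exact: (link_segment_image ij).
have O12 y : O S y -> O (~` S) y -> False.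
  move=> [z [i [j [ij [Ui Si] [Uj Sj] zij]]] zy] [x [k [l [kl [Uk Sk] [Ul Sl] xkl]]] xy].
  have : 1 / 2 <= dist2 z x.
    apply: (link_segments_apart pc ij kl _ zij xkl).
    by apply/and4P; split; apply/eqP => E; move: Sk Sl; rewrite /= -?E.
  have : ball z (1 / 4 + 1 / 4) x by apply: ball_triangle zy _; exact: ball_sym.
  by move=> /dist2_lt => /(_ ltac:(lra)); lra.
(* The thickened complement of [U]: it is open because every boundary point of [U] lies on a link
   with both ends in [S] or both outside. Its intersection with [U] splits into the two thin
   parts. *)
pose B := ~` U `|` (O S `|` O (~` S)).
have linkS i j : link c i j -> face_vertices c U i -> face_vertices c U j -> S i -> S j.
  by move=> /orP[/eqP->//|ij] Ui Uj Si; exact: (Sadj i j).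
have oB : open B.
  rewrite openE => z; have nO S' : O S' z -> nbhs z (O S').
    by move=> Oz; apply: open_nbhs_nbhs.
  have [/nO Oz _|nO1] := pselect (O S z).
    by apply: filterS Oz => y Oy; right; left.
  have [/nO Oz _|nO2] := pselect (O (~` S) z).
    by apply: filterS Oz => y Oy; right; right.
  move=> [nUz|[|]//]; have [cz|ncz] := pselect (closure U z).
    have [i [j [ij Ui Uj zij]]] := face_boundary_link pc cG fU cz nUz; exfalso.
    have [Si|nSi] := pselect (S i).
      by apply: nO1; apply: FO; exists i, j; split=> //; split=> //; exact: linkS ij _ _ _.
    apply: nO2; apply: FO; exists i, j; split=> //; split=> // Sj; apply: nSi.
    by apply: linkS Sj => //; rewrite link_sym.
  have : nbhs z (~` closure U).
    by apply: open_nbhs_nbhs; split=> //; apply: closed_openC; exact: closed_closure.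
  apply: filterS => y ncy; left => Uy; apply: ncy; exact: subset_closure.
have cB : connected B.
  apply: locally_constant_connected => s sB.
  have sU y z : ~ U y -> ~ U z -> s y = s z.
    apply: (connected_locally_constant (connected_face_complement pc cG fU) (s := s)).
    by apply: locally_constant_subset sB => x; left.
  have sO S' : O S' `<=` B -> forall y, O S' y -> exists2 z, ~ U z & s y = s z.
    move=> OB y [z Fz zy]; exists z; first exact: nUF Fz.
    have z4 : 0 < 1 / 4 :> R by lra.
    apply: (connected_locally_constant (connected_ball (z := z) z4) (s := s)) => //.
      by apply: locally_constant_subset sB => x zx; apply: OB; exists z.
    exact: ballxx.
  have toU y : B y -> exists2 z, ~ U z & s y = s z.
    move=> [nU|[]]; first by exists y.
      by apply: sO => x Ox; right; left.
    by apply: sO => x Ox; right; right.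
  by move=> x y /toU[x' nUx' ->] /toU[y' nUy' ->]; exact: sU.
have meet S' i : S' i -> face_vertices c U i -> exists y, U y /\ O S' y.
  move=> Si Ui; have i4 : 0 < 1 / 4 :> R by lra.
  have [y [Uy iy]] := Ui _ (nbhsx_ballx (c i) (1 / 4) i4).
  exists y; split=> //; exists (c i) => //; exists i, i; split=> //.
    by rewrite /link eqxx.
  exact: segment_left.
have [p [Up Op]] := meet S v Sv Uv; have [q [Uq Oq]] := meet (~` S) w nSw Uw.
have oU := open_face pc fU.
apply: (@unicoherent_plane _ U B (U `&` O S) (U `&` O (~` S)) oU oB _ _ _ _ _ p q) => //.
- exact: openI.
- exact: openI.
- by move=> z; have [|] := pselect (U z); [left|right; left].
- by move=> z [_ /O12 h] [_ /h].
- by move=> z Uz [//|[|]]; [left|right].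
- exact: connected_face fU.
- by move=> z [Uz Oz]; split=> //; right; left.
- by move=> z [Uz Oz]; split=> //; right; right.
Qed.

Lemma face_vertices_joined U v w : faces c U -> face_vertices c U v -> face_vertices c U w ->
  joined (adj c) (face_vertices c U) v w.
Proof.
move=> fU Uv Uw; apply: (@face_vertices_closed U _ v w fU) => //; last exact: joined_refl.
move=> i j /= vi Ui Uj ij; apply: joined_trans vi _; exact: joined_edge.
Qed.

Lemma adj_bounds i j : adj c i j ->
  `|(c i).1 - (c j).1| <= 1 /\ `|(c i).2 - (c j).2| <= 1.
Proof.
move=> /adj_dist2; rewrite /dist2; move: (_ - _) (_ - _) => a b h.
by rewrite !ler_norml; split; apply/andP; split; nra.
Qed.

Lemma path_bounds v p : path (adj c) v p ->
  `|(c v).1 - (c (last v p)).1| <= (size p)%:R /\ `|(c v).2 - (c (last v p)).2| <= (size p)%:R.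
Proof.
elim: p v => [v _|w p IH v] /=; first by rewrite !subrr !normr0.
move=> /andP[/adj_bounds[h1 h2] /IH[h3 h4]]; rewrite -natr1.
split.
  apply: le_trans (ler_distD (c w).1 _ _) _; lra.
apply: le_trans (ler_distD (c w).2 _ _) _; lra.
Qed.

Lemma face_vertices_bounds U v w : faces c U -> face_vertices c U v -> face_vertices c U w ->
  `|(c v).1 - (c w).1| <= D%:R /\ `|(c v).2 - (c w).2| <= D%:R.
Proof.
move=> fU Uv Uw; have [p [pp lp up pU]] := joined_uniq (face_vertices_joined fU Uv Uw).
have := face_vertices_size hD fU up pU => /= /ltnW; rewrite -(ler_nat R) => sD.
by have := path_bounds pp; rewrite lp => -[h1 h2]; split; apply: le_trans sD.
Qed.

Lemma face_vertices_nonempty U : faces c U -> face_vertices c U !=set0.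
Proof.
move=> fU; have [p Up] := face_nonempty fU.
have [] := face_exit pc fU (@connected_segment _ p (c 0%N)).
- by exists p; split=> //; exact: segment_left.
- exists (c 0%N); split; first exact: segment_right.
  by move=> U0; apply: (face_image fU U0); exact: image_vertex.
move=> z [_ cz Gz]; have nUz : ~ U z by move=> /(face_image fU); exact.
by have [i [j [_ Ui _ _]]] := face_boundary_link pc cG fU cz nUz; exists i.
Qed.

(** The boundary links of [U] have their ends, hence all their points, in the convex square of
    half-side [D] around [c v]. The connected outside of the square thus misses the boundary of
    [U]. *)
Lemma face_bounded U v z : faces c U -> face_vertices c U v -> U z ->
  `|(c v).1 - z.1| <= D%:R /\ `|(c v).2 - z.2| <= D%:R.
Proof.
move=> fU Uv Uz.
pose X := [set y : T | D%:R < `|y.1 - (c v).1| \/ D%:R < `|y.2 - (c v).2|].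
suff nX : ~ X z.
  by split; rewrite distrC leNgt; apply/negP => h; apply: nX; [left|right].
move=> Xz; have XU : X `<=` U.
  apply: (connected_sub_open (open_face pc fU) (@connected_outside_square R (c v) D%:R)).
    by exists z.
  move=> y [Xy cy]; apply: contrapT => nUy.
  have [i [j [_ Ui Uj [t /=]]]] := face_boundary_link pc cG fU cy nUy.
  rewrite in_itv /= => /andP[t0 t1] yE.
  have [] := face_vertices_bounds fU Ui Uv; have [] := face_vertices_bounds fU Uj Uv.
  rewrite !ler_norml => /andP[? ?] /andP[? ?] /andP[? ?] /andP[? ?].
  move: Xy; rewrite /X -yE /= !ltNge !ler_norml => -[|] /negP; apply; apply/andP; split; nra.
have := packing_finite pc (c v) D%:R.
rewrite (_ : [set i | _] = setT); first exact: infinite_nat.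
apply/seteqP; split=> // i _ /=.
have nXi : ~ X (c i) by move=> /XU /(face_image fU); apply; exact: image_vertex.
by split; rewrite leNgt; apply/negP => h; apply: nXi; [left|right].
Qed.

(** * From connected sets in the plane to paths in the graph *)

Definition shadow (L : set T) (r : R) : set nat :=
  [set v | exists z, [/\ L z, `|(c v).1 - z.1| <= r & `|(c v).2 - z.2| <= r]].

(** The vertices attached to [z]: those of its face if [z] is off the image, the ends of the links
    through it otherwise. *)
Let touch z v := (exists U, [/\ faces c U, U z & face_vertices c U v]) \/
  (exists j, link c v j /\ segment (c v) (c j) z).

(** If [z] is on the image and [y] in a face, the segment from [y] to [z] leaves the face at a point
    of a boundary link; by the choice of [e] this link also passes through [z], so its ends serve
    both points. *)
Let touch_near z : \forall y \near z, exists v, touch z v /\ touch y v.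
Proof.
have [Gz|nGz] := pselect (G z); last first.
  have [U fU Uz] := exists_face nGz; have [v Uv] := face_vertices_nonempty fU.
  have : nbhs z U by apply: open_nbhs_nbhs; split=> //; exact: (open_face pc fU).
  by apply: filterS => y Uy; exists v; split; left; exists U.
have [e e0 eP] := segments_near pc z.
apply/nbhs_ballP; exists e => // y zy.
have [/embedded_imageP[i [j [ij yij]]]|nGy] := pselect (G y).
  by exists i; split; right; exists j; split=> //; exact: (eP y).
have [U fU Uy] := exists_face nGy.
have nUG x : G x -> ~ U x by move=> Gx /(face_image fU); exact.
have [] := face_exit pc fU (@connected_segment _ y z).
- by exists y; split=> //; exact: segment_left.
- by exists z; split; [exact: segment_right|exact: nUG].
move=> x [yzx cx Gx].
have [i [j [ij Ui Uj xij]]] := face_boundary_link pc cG fU cx (nUG _ Gx).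
exists i; split; last by left; exists U.
right; exists j; split=> //; apply: (eP x) => //.
by apply: segment_ball yzx => //; exact: ballxx.
Qed.

Let touch_shadow L z v : L z -> touch z v -> shadow L (D%:R + 1) v.
Proof.
move=> Lz [[U [fU Uz Uv]]|[j [vj [t /=]]]].
  by have [h1 h2] := face_bounded fU Uv Uz; exists z; split=> //; lra.
rewrite in_itv /= => /andP[t0 t1] zE.
have D0 : 0 <= D%:R :> R by rewrite ler0n.
have b (x : R) : `|x| <= 1 -> - 1 <= t * x <= 1.
  by rewrite ler_norml => /andP[? ?]; apply/andP; split; nra.
have [/b/andP[? ?] /b/andP[? ?]] : `|(c v).1 - (c j).1| <= 1 /\ `|(c v).2 - (c j).2| <= 1.
  by move: vj => /orP[/eqP->|/adj_bounds//]; rewrite !subrr !normr0 ler01.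
by exists z; rewrite -{2 3}zE /= !ler_norml; split=> //; apply/andP; split; lra.
Qed.

(** On the image, two links through the same point must share an end; off it, both vertices belong
    to the face of [z]. *)
Let touch_joined L z v w : L z -> touch z v -> touch z w ->
  joined (adj c) (shadow L (D%:R + 1)) v w.
Proof.
move=> Lz tv tw; set S := shadow _ _.
have tS i : touch z i -> S i by exact: touch_shadow.
have tlink i j : link c i j -> segment (c i) (c j) z -> joined (adj c) S i j.
  move=> ij zij; have Si : S i by apply: tS; right; exists j.
  have Sj : S j by apply: tS; right; exists i; rewrite link_sym; split=> //; exact: segmentC.
  by move: ij => /orP[/eqP<-|]; [exact: joined_refl|exact: joined_edge].
have G_of i j : link c i j -> segment (c i) (c j) z -> G z.
  by move=> ij; exact: link_segment_image.
case: tv tw => [[U [fU Uz Uv]]|[j [vj zvj]]] [[U' [fU' U'z Uw]]|[k [wk zwk]]].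
- rewrite -(faces_eq fU fU' Uz U'z) in Uw.
  apply: joined_subset (face_vertices_joined fU Uv Uw) => i Ui.
  by apply: tS; left; exists U.
- by case: (face_image fU Uz); exact: G_of wk zwk.
- by case: (face_image fU' U'z); exact: G_of vj zvj.
- have [n4|] := boolP [&& v != w, v != k, j != w & j != k].
    have := link_segments_apart pc vj wk n4 zvj zwk.
    by rewrite /dist2 !subrr expr0n /= addr0; lra.
  have jv := joined_sym (@adj_sym R c) (tlink _ _ vj zvj).
  have kw := joined_sym (@adj_sym R c) (tlink _ _ wk zwk).
  rewrite !negb_and !negbK => /or4P[] /eqP E.
  + by rewrite -E; apply: joined_refl; apply: tS; right; exists j.
  + by rewrite E.
  + by rewrite -E; exact: tlink.
  + by rewrite -E in kw; exact: joined_trans (tlink _ _ vj zvj) kw.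
Qed.

(** Along [L], the property of touching a vertex joined to [u] is locally constant: nearby points
    touch a common vertex, and all vertices touched by one point are joined. *)
Lemma shadow_joined L u w : connected L -> L (c u) -> L (c w) ->
  joined (adj c) (shadow L (D%:R + 1)) u w.
Proof.
move=> cL Lu Lw; set S := shadow _ _.
have touch_self i : touch (c i) i.
  by right; exists i; split; [rewrite /link eqxx|exact: segment_left].
pose s z := `[< exists v, touch z v /\ joined (adj c) S u v >].
have sL : locally_constant L s.
  move=> z Lz; have := touch_near z; apply: filterS => y [v [zv yv]] Ly.
  apply/asboolP/asboolP => -[i [ti ui]]; exists v; split=> //;
    apply: joined_trans ui _; [exact: (@touch_joined L y)|exact: (@touch_joined L z)].
have /asboolP : s (c w).
  rewrite -(connected_locally_constant cL sL Lu Lw); apply/asboolP; exists u; split=> //.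
  by apply: joined_refl; exact: (touch_shadow Lu).
move=> [v [wv uv]]; apply: joined_trans uv _; exact: (@touch_joined L (c w)).
Qed.

Lemma vertex_near z : exists v, `|(c v).1 - z.1| <= D%:R + 1 /\ `|(c v).2 - z.2| <= D%:R + 1.
Proof.
have [v [tv _]] := nbhs_singleton (touch_near z).
by have [y [<- ? ?]] := touch_shadow (L := [set z]) erefl tv; exists v.
Qed.

End penny_graph.

(** * Volume growth *)

(** Walk lengths are integers, so an infimum at most [r] yields a walk of length less than
    [Num.truncn r + 1], hence at most [r]. *)
Lemma graph_ballP (R : realType) (V : eqType) (e : rel V) (x y : V) (r : R) :
  graph_ball e x r y <-> exists p, [/\ path e y p, last y p = x & (size p)%:R <= r].
Proof.
rewrite /graph_ball /graph_dist; split=> [yr|[p [pp lp pr]]]; last first.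
  apply: le_trans (_ : (size p)%:R%:E <= _)%E; last by rewrite lee_fin.
  by apply: ereal_inf_lbound; exists p.
have r0 : 0 <= r.
  rewrite leNgt; apply/negP => r0.
  have r0' : (r%:E < 0%:E)%E by rewrite lte_fin.
  have /ereal_inf_lt[_ [p _ <-]] := le_lt_trans yr r0'.
  by rewrite lte_fin ltNge ler0n.
have /andP[rl ru] := truncn_itv r0.
have : (r%:E < (Num.truncn r).+1%:R%:E)%E by rewrite lte_fin.
move=> /(le_lt_trans yr) /ereal_inf_lt[_ [p [pp lp] <-]].
rewrite lte_fin ltr_nat ltnS => ps; exists p; split=> //.
by apply: le_trans rl; rewrite ler_nat.
Qed.

(* Every point of the plane is within [mesh] of a vertex; [stretch * r] bounds the
   number of vertices within [mesh] of an L-shaped path with legs at most [r]; a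
   ball of radius [growth * n] has at least [n ^ 2] vertices. *)
Definition mesh (R : realType) (D : nat) : R := D%:R + 1.

Definition stretch (R : realType) (D : nat) : R := 90 * mesh R D ^+ 2.

Definition growth (R : realType) (D : nat) : R := 3 * mesh R D * stretch R D.

Section penny_graph.
Variables (R : realType) (D : nat) (c : nat -> R * R).
Local Notation T := (R * R)%type.
Local Notation K := (mesh R D).
Local Notation kappa := (stretch R D).
Local Notation m := (growth R D).
Hypotheses (pc : penny_packing c) (cG : graph_connected (adj c)).
Hypothesis hD : (ereal_sup [set facial_degree c U | U in faces c] <= D%:R%:E)%E.

Lemma mesh_ge1 : 1 <= K.
Proof. by have := ler0n R D; rewrite /mesh; lra. Qed.

Lemma stretch_ge1 : 1 <= kappa.
Proof. by rewrite /stretch; have := mesh_ge1; nra. Qed.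

Lemma growth_ge1 : 1 <= m.
Proof. by rewrite /growth; have := mesh_ge1; have := stretch_ge1; nra. Qed.

Definition near_in (a b : R) : rel nat := fun i j =>
  (`|(c i).1 - (c j).1| <= a) && (`|(c i).2 - (c j).2| <= b).

Lemma near_in_sym a b : symmetric (near_in a b).
Proof. by move=> i j; rewrite /near_in distrC [X in _ && (X <= _)]distrC. Qed.

Lemma near_in_count a b u (s : seq nat) : 0 <= a -> 0 <= b -> uniq s ->
  {in s, forall v, near_in a b u v} -> (size s)%:R <= (4 * a + 1) * (4 * b + 1).
Proof.
move=> a0 b0 us sP.
have := @packing_count _ _ pc ((c u).1 - a) ((c u).1 + a) ((c u).2 - b) ((c u).2 + b) s.
have -> : 2 * ((c u).1 + a - ((c u).1 - a)) + 1 = 4 * a + 1 by ring.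
have -> : 2 * ((c u).2 + b - ((c u).2 - b)) + 1 = 4 * b + 1 by ring.
apply=> //; try lra.
move=> i /sP; rewrite /near_in !ler_norml => /andP[/andP[? ?] /andP[? ?]].
by split; apply/andP; split; lra.
Qed.

(* The vertices shadowing the L-shaped path from [c u] to [c w] with corner
   [((c w).1, (c u).2)]. *)
Definition manhattan (r : R) u w v := near_in (r + K) K u v || near_in K (r + K) w v.

Lemma manhattan_near r u w v : 0 <= r -> near_in r r u w -> manhattan r u w v ->
  near_in (r + r + K) (r + r + K) u v.
Proof.
have K1 := mesh_ge1; move=> r0; rewrite /manhattan /near_in !ler_norml.
move=> /andP[/andP[? ?] /andP[? ?]] /orP[] /andP[/andP[? ?] /andP[? ?]];
  by apply/andP; split; apply/andP; split; lra.
Qed.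

(** A path without repetition is no longer than the number of vertices in its two strips. As [r] and
    [K] are at least 1, each strip holds at most [9 * (K * r)] times [5 * K] of them, hence the
    constant 90 in [stretch]. *)
Lemma manhattan_path r u w : 1 <= r -> near_in r r u w ->
  exists p, [/\ path (adj c) u p, last u p = w, uniq (u :: p),
    {in u :: p, forall v, manhattan r u w v} & (size p)%:R <= kappa * r].
Proof.
move=> r1 /andP[]; rewrite !ler_norml => /andP[h1 h2] /andP[h3 h4].
have K1 := mesh_ge1.
pose L := segment (c u) ((c w).1, (c u).2) `|` segment ((c w).1, (c u).2) (c w).
have cL : connected L.
  apply: connectedU; try exact: connected_segment.
  by exists ((c w).1, (c u).2); split; [exact: segment_right|exact: segment_left].
have Lu : L (c u) by left; exact: segment_left.
have Lw : L (c w) by right; exact: segment_right.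
have [p [pp lp up pS]] := joined_uniq (shadow_joined pc cG hD cL Lu Lw).
have pM : {in u :: p, forall v, manhattan r u w v}.
  move=> v /pS[z [Lz]]; rewrite /manhattan /near_in -/K !ler_norml.
  move=> /andP[k1 k2] /andP[k3 k4]; case: Lz => -[t /=]; rewrite in_itv /= => /andP[t0 t1] zE;
    move: k1 k2 k3 k4; rewrite -zE /= => k1 k2 k3 k4; apply/orP; [left|right].
    by apply/andP; split; apply/andP; split; nra.
  by apply/andP; split; apply/andP; split; nra.
exists p; split=> //.
pose s1 := [seq v <- u :: p | near_in (r + K) K u v].
pose s2 := [seq v <- u :: p | near_in K (r + K) w v].
have : (size (u :: p) <= size s1 + size s2)%N.
  rewrite !size_filter -count_predUI; apply: leq_trans (leq_addr _ _).
  by rewrite eq_leq//; apply/esym/eqP; rewrite -all_count; apply/allP => v /pM.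
rewrite -(ler_nat R) natrD /= -natr1.
have n1 : (size s1)%:R <= (4 * (r + K) + 1) * (4 * K + 1).
  apply: (@near_in_count _ _ u); [lra|lra|exact: filter_uniq|].
  by move=> v; rewrite mem_filter => /andP[].
have n2 : (size s2)%:R <= (4 * K + 1) * (4 * (r + K) + 1).
  apply: (@near_in_count _ _ w); [lra|lra|exact: filter_uniq|].
  by move=> v; rewrite mem_filter => /andP[].
have Kr : K <= K * r by nra.
have Kr' : r <= K * r by nra.
have n3 : (4 * (r + K) + 1) * (4 * K + 1) <= (9 * (K * r)) * (5 * K) by apply: ler_pM; lra.
rewrite /stretch; move: n1 n2 n3; rewrite [(4 * K + 1) * _]mulrC.
have -> : 9 * (K * r) * (5 * K) = 45 * K ^+ 2 * r by ring.
lra.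
Qed.

Definition ball_vertices (x : nat) (r : R) : {fset nat} := fset_set (graph_ball (adj c) x r).

Lemma ball_verticesP x r y : reflect
  (exists p, [/\ path (adj c) y p, last y p = x & (size p)%:R <= r]) (y \in ball_vertices x r).
Proof.
apply: (iffP idP); rewrite in_fset_set; try exact: graph_ball_finite.
  by move=> /set_mem /graph_ballP.
by move=> /graph_ballP /mem_set.
Qed.

Lemma ball_vertices_center x r : 0 <= r -> x \in ball_vertices x r.
Proof. by move=> r0; apply/ball_verticesP; exists [::]. Qed.

Lemma ball_vertices_sym x y r : y \in ball_vertices x r -> x \in ball_vertices y r.
Proof.
move=> /ball_verticesP[p [pp <- pr]]; apply/ball_verticesP.
exists (rev (belast y p)); rewrite size_rev size_belast; split=> //.
  by rewrite rev_path (eq_path (e' := adj c))// => i j; rewrite adj_sym.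
by case: p pp pr => //= i p _ _; rewrite rev_cons last_rcons.
Qed.

Lemma ball_vertices_trans x y z r s : z \in ball_vertices y s -> y \in ball_vertices x r ->
  z \in ball_vertices x (r + s).
Proof.
move=> /ball_verticesP[p [pp lp ps]] /ball_verticesP[q [qq lq qr]].
apply/ball_verticesP; exists (p ++ q).
by rewrite cat_path last_cat size_cat natrD lp pp qq lq; split=> //; lra.
Qed.

Lemma ball_vertices_le x y r s : r <= s -> y \in ball_vertices x r -> y \in ball_vertices x s.
Proof.
move=> rs /ball_verticesP[p [pp lp pr]]; apply/ball_verticesP; exists p; split=> //.
exact: le_trans rs.
Qed.

Lemma ball_vertices_near x y r : y \in ball_vertices x r -> near_in r r x y.
Proof.
rewrite near_in_sym => /ball_verticesP[p [pp <- pr]]; have [h1 h2] := path_bounds pp.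
by rewrite /near_in !(le_trans _ pr).
Qed.

Lemma near_ball_vertices x y r : 1 <= r -> near_in r r x y -> y \in ball_vertices x (kappa * r).
Proof.
rewrite near_in_sym => r1 /(manhattan_path r1)[p [pp lp _ _ ps]].
by apply/ball_verticesP; exists p.
Qed.

Lemma volume_upper x r : 0 <= r -> (#|` ball_vertices x r|)%:R <= (4 * r + 1) ^+ 2.
Proof.
move=> r0; rewrite expr2; apply: (@near_in_count _ _ x) => //; first exact: fset_uniq.
by move=> v; exact: ball_vertices_near.
Qed.

Lemma volume_ge1 x r : 0 <= r -> 1 <= (#|` ball_vertices x r|)%:R :> R.
Proof.
by move=> r0; rewrite ler1n cardfs_gt0; apply/fset0Pn; exists x; exact: ball_vertices_center.
Qed.

(** Take a vertex within [K] of each point of an [n] by [n] grid of spacing [3 * K]; the spacing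
    makes these vertices distinct. The factor 4 comes from [r < m * (n + 1) <= 2 * m * n]; for
    [n = 0] the center alone suffices. *)
Lemma volume_lower x r : 0 < r -> r ^+ 2 <= 4 * m ^+ 2 * (#|` ball_vertices x r|)%:R.
Proof.
move=> r0; have m1 := growth_ge1; have K1 := mesh_ge1; have k1 := stretch_ge1.
have b1 := volume_ge1 x (ltW r0).
pose n := Num.truncn (r / m).
have m0 : 0 < m by lra.
have /andP[nr rn] : n%:R <= r / m < n.+1%:R by apply: truncn_itv; rewrite divr_ge0// ltW.
rewrite ler_pdivlMr// in nr; rewrite ltr_pdivrMr// -natr1 in rn.
have [n0|n_gt0] := posnP n.
  rewrite n0 add0r mul1r in rn.
  have : r ^+ 2 <= m ^+ 2 by rewrite ler_sqr ?nnegrE ltW.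
  have := sqr_ge0 m; nra.
have n1 : 1 <= n%:R :> R by rewrite ler1n.
have [v vP] : exists v : nat * nat -> nat, forall ij,
    `|(c (v ij)).1 - ((c x).1 + 3 * K * ij.1%:R)| <= K /\
    `|(c (v ij)).2 - ((c x).2 + 3 * K * ij.2%:R)| <= K.
  have := fun ij : nat * nat => vertex_near pc cG hD
    ((c x).1 + 3 * K * ij.1%:R, (c x).2 + 3 * K * ij.2%:R).
  by move=> /choice[v vP]; exists v.
have close (i j : nat) a y : `|y - (a + 3 * K * i%:R)| <= K ->
    `|y - (a + 3 * K * j%:R)| <= K -> i = j :> nat.
  rewrite !ler_norml => /andP[? ?] /andP[? ?]; apply/eqP; rewrite eqn_leq.
  have lt1 k l : (3 * K * k%:R <= 3 * K * l%:R + 2 * K) -> (k <= l)%N.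
    move=> kl; rewrite leqNgt -(ler_nat R) -natr1 -ltNge.
    have : 0 < K by lra.
    by move=> K0; rewrite -(ltr_pM2l K0); nra.
  by apply/andP; split; apply: lt1; lra.
have nb : (n * n <= #|` ball_vertices x r|)%N.
  rewrite (_ : (n * n)%N = size (map v [seq (i, j) | i <- iota 0 n, j <- iota 0 n]));
    last by rewrite size_map size_allpairs !size_iota.
  apply: uniq_leq_size.
    rewrite map_inj_uniq.
      by apply: allpairs_uniq; rewrite ?iota_uniq// => -[? ?] [? ?].
    move=> [i j] [k l] e; have [/= h1 h2] := vP (i, j); have [/= h3 h4] := vP (k, l).
    by rewrite e in h1 h2; rewrite (close _ _ _ _ h1 h3) (close _ _ _ _ h2 h4).
  move=> _ /mapP[_ /allpairsP[[i j] [/= + + ->]] ->].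
  rewrite !mem_iota !add0n /= => ilt jlt.
  have le3 k : (k < n)%N -> 0 <= 3 * K * k%:R <= 3 * K * n%:R - 3 * K.
    move=> kn; apply/andP; split; first by rewrite !mulr_ge0//; lra.
    have : k.+1%:R <= n%:R :> R by rewrite ler_nat.
    by rewrite -natr1; nra.
  have [/=] := vP (i, j); rewrite !ler_norml => /andP[? ?] /andP[? ?].
  have /andP[? ?] := le3 _ ilt; have /andP[? ?] := le3 _ jlt.
  apply: ball_vertices_le (_ : kappa * (3 * K * n%:R) <= _) _.
    by apply: le_trans nr; rewrite /growth; lra.
  apply: near_ball_vertices; first nra.
  by rewrite /near_in !ler_norml; apply/andP; split; apply/andP; split; lra.
have : r <= 2 * m * n%:R by nra.
have : n%:R * n%:R <= (#|` ball_vertices x r|)%:R :> R by rewrite -natrM ler_nat.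
move=> nN rm.
have p0 : 0 <= 2 * m * n%:R by nra.
have : r ^+ 2 <= (2 * m * n%:R) ^+ 2 by rewrite ler_sqr ?nnegrE//; exact: ltW.
have := sqr_ge0 m; nra.
Qed.

(** The constant comes from [(8 * r + 1) ^+ 2 <= 128 * r ^+ 2 + 2], with [r ^+ 2] bounded by
    [volume_lower] and 1 by the volume. *)
Lemma volume_doubling x r : 0 < r ->
  (#|` ball_vertices x (2 * r)|)%:R <= (512 * m ^+ 2 + 2) * (#|` ball_vertices x r|)%:R.
Proof.
move=> r0; have := @volume_upper x (2 * r) ltac:(lra).
have := volume_lower x r0; have := volume_ge1 x (ltW r0).
have := sqr_ge0 (8 * r - 1); lra.
Qed.

End penny_graph.

(** * Poincare inequality *)

Section sums.
Variable R : realType.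

Lemma sum_uniq_le (V : eqType) (s t : seq V) (P : pred V) (g : V -> R) :
  uniq s -> uniq t -> {in s, forall v, v \in t /\ P v} -> (forall v, 0 <= g v) ->
  \sum_(v <- s) g v <= \sum_(v <- t | P v) g v.
Proof.
move=> us ut st g0.
rewrite (perm_big [seq v <- t | v \in s]) /=; last first.
  apply: uniq_perm => //; first exact: filter_uniq.
  move=> v; rewrite mem_filter; case: (boolP (v \in s)) => //= /st[-> _] //.
rewrite big_filter [leLHS]big_mkcond [leRHS]big_mkcond /=.
apply: ler_sum => v _; case: (boolP (v \in s)) => [/st[_ ->]//|_].
by case: (P v).
Qed.

Lemma sum_orb_le (V : Type) (s : seq V) (P Q : pred V) (g : V -> R) :
  (forall v, 0 <= g v) ->
  \sum_(v <- s | P v || Q v) g v <= \sum_(v <- s | P v) g v + \sum_(v <- s | Q v) g v.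
Proof.
move=> g0; rewrite [leLHS]big_mkcond [X in _ <= X + _]big_mkcond.
rewrite [X in _ <= _ + X]big_mkcond -big_split /=; apply: ler_sum => v _.
by case: (P v); case: (Q v); rewrite /= ?addr0 ?add0r// lerDl.
Qed.

(** Double counting: the innermost sum does not depend on [w], so summing over [w] costs [a]; each
    [v] is then met by at most [b] values of [u]. *)
Lemma sum_incidence_le (V : Type) (X Y : seq V) (N H : V -> pred V) (g : V -> R) (a b : R) :
  0 <= a -> (forall v, 0 <= g v) ->
  (forall u, \sum_(w <- X | N u w) 1 <= a) -> (forall v, \sum_(u <- X | H u v) 1 <= b) ->
  \sum_(u <- X) \sum_(w <- X | N u w) \sum_(v <- Y | H u v) g v
    <= a * b * \sum_(v <- Y) g v.
Proof.
move=> a0 g0 Na Hb.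
apply: (@le_trans _ _ (\sum_(u <- X) a * \sum_(v <- Y | H u v) g v)).
  apply: ler_sum => u _; rewrite -[X in \sum_(w <- _ | _) X]mul1r -mulr_suml.
  by apply: ler_wpM2r => //; apply: sumr_ge0.
rewrite -mulr_sumr -mulrA; apply: ler_wpM2l => //.
rewrite (exchange_big_dep xpredT) //= mulr_sumr.
apply: ler_sum => v _; rewrite -[X in \sum_(u <- _ | _) X]mul1r -mulr_suml.
exact: ler_wpM2r.
Qed.

Definition average (V : Type) (s : seq V) (f : V -> R) : R :=
  (size s)%:R^-1 * \sum_(v <- s) f v.

Lemma variance_identity (V : Type) (s : seq V) (f : V -> R) (a : R) : (0 < size s)%N ->
  \sum_(v <- s) (f v - a) ^+ 2 =
  \sum_(v <- s) (f v - average s f) ^+ 2 + (size s)%:R * (average s f - a) ^+ 2.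
Proof.
move=> s0; have s0' : (size s)%:R != 0 :> R by rewrite pnatr_eq0 -lt0n.
have expand b : \sum_(v <- s) (f v - b) ^+ 2 =
    \sum_(v <- s) f v ^+ 2 - 2 * b * (\sum_(v <- s) f v) + (size s)%:R * b ^+ 2.
  rewrite mulr_sumr -sumrB.
  have -> : (size s)%:R * b ^+ 2 = \sum_(v <- s) b ^+ 2.
    by rewrite big_const_seq count_predT iter_addr_0 mulr_natl.
  by rewrite -big_split /=; apply: eq_bigr => v _; ring.
have -> : \sum_(v <- s) (f v - a) ^+ 2 = \sum_(v <- s) f v ^+ 2
    - 2 * a * ((size s)%:R * average s f) + (size s)%:R * a ^+ 2.
  by rewrite expand /average mulVKf.
have -> : \sum_(v <- s) (f v - average s f) ^+ 2 = \sum_(v <- s) f v ^+ 2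
    - 2 * average s f * ((size s)%:R * average s f) + (size s)%:R * average s f ^+ 2.
  by rewrite expand {2}/average mulVKf.
ring.
Qed.

Lemma average_sqr_le (V : Type) (s : seq V) (f : V -> R) (a : R) : (0 < size s)%N ->
  (a - average s f) ^+ 2 <= (size s)%:R^-1 * \sum_(v <- s) (a - f v) ^+ 2.
Proof.
move=> s0; have s0' : 0 < (size s)%:R :> R by rewrite ltr0n.
rewrite ler_pdivlMl//.
have -> : \sum_(v <- s) (a - f v) ^+ 2 = \sum_(v <- s) (f v - a) ^+ 2.
  by apply: eq_bigr => v _; ring.
rewrite (variance_identity f a s0) -[X in _ * X <= _]sqrrN opprB.
by rewrite lerDr; apply: sumr_ge0 => v _; exact: sqr_ge0.
Qed.

End sums.

Section penny_graph.
Variables (R : realType) (D : nat) (c : nat -> R * R).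
Local Notation K := (mesh R D).
Local Notation kappa := (stretch R D).
Local Notation m := (growth R D).
Hypotheses (pc : penny_packing c) (cG : graph_connected (adj c)).
Hypothesis hD : (ereal_sup [set facial_degree c U | U in faces c] <= D%:R%:E)%E.
Variable f : nat -> R.
Implicit Types X Y : {fset nat}.

(** The energy is localised at vertices so that a path can be charged through the vertices it
    visits, which are what the strips count. *)
Definition vertex_energy Y v := \sum_(w <- Y | adj c v w) (f v - f w) ^+ 2.

Definition energy Y := \sum_(v <- Y) vertex_energy Y v.

Lemma vertex_energy_ge0 Y v : 0 <= vertex_energy Y v.
Proof. by apply: sumr_ge0 => w _; exact: sqr_ge0. Qed.

Lemma energy_ge0 Y : 0 <= energy Y.
Proof. by apply: sumr_ge0 => v _; exact: vertex_energy_ge0. Qed.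

(** Cauchy-Schwarz by induction, as [(a + b)^2 <= (n + 1) (a^2 + b^2 / n)]; the edge leaving [v] is
    charged to [vertex_energy Y v]. The case [n = 0] is separate because of the division. *)
Lemma path_energy Y u p : path (adj c) u p -> {subset u :: p <= Y} ->
  (f u - f (last u p)) ^+ 2 <= (size p)%:R * \sum_(v <- u :: p) vertex_energy Y v.
Proof.
elim: p u => [u _ _|w p IH u /= /andP[uw wp] sY] /=; first by rewrite subrr expr0n mul0r.
have {}IH := IH w wp (fun v vp => sY v (mem_behead (s := u :: w :: p) vp)).
have uE : (f u - f w) ^+ 2 <= vertex_energy Y u.
  have wY : w \in Y by apply: sY; rewrite !inE eqxx orbT.
  rewrite /vertex_energy -big_filter (bigD1_seq w) ?mem_filter ?uw ?filter_uniq ?fset_uniq//= lerDl.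
  by apply: sumr_ge0 => v _; exact: sqr_ge0.
rewrite big_cons -natr1; move: uE IH.
have : 0 <= \sum_(v <- w :: p) vertex_energy Y v.
  by apply: sumr_ge0 => v _; exact: vertex_energy_ge0.
set S := \sum_(v <- _) _; move=> S0.
have -> : f u - f (last w p) = (f u - f w) + (f w - f (last w p)) by ring.
move: (f u - f w) (f w - _) (vertex_energy _ _) => a b e ae bS.
have [n0|n_gt0] := posnP (size p).
  move: bS; rewrite n0 mul0r => b0.
  have /eqP -> : b == 0 by rewrite -sqrf_eq0 eq_le b0 sqr_ge0.
  by rewrite addr0 add0r mul1r; lra.
have n1 : 0 < (size p)%:R :> R by rewrite ltr0n.
move: (size p)%:R n1 bS => n n1 bS.
have : 0 <= n * (n * a ^+ 2 + S - 2 * a * b) by have := sqr_ge0 (n * a - b); nra.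
rewrite pmulr_rge0// => h; have : 0 <= n * (e - a ^+ 2) by rewrite mulr_ge0//; lra.
nra.
Qed.

Lemma count_near_in X (a b : R) u : 0 <= a -> 0 <= b ->
  \sum_(w <- X | near_in c a b u w) 1 <= (4 * a + 1) * (4 * b + 1).
Proof.
move=> a0 b0; rewrite -big_filter big_const_seq count_predT iter_addr_0.
apply: (near_in_count pc a0 b0 (u := u)); first by rewrite filter_uniq// fset_uniq.
by move=> v; rewrite mem_filter => /andP[].
Qed.

(* Multicommodity flow along L-shaped paths: each path has [O(r)] vertices and
   each vertex is on [O(r ^ 3)] of them. *)
Lemma pair_energy X Y r : 1 <= r ->
  (forall u w v, u \in X -> w \in X -> near_in c r r u w -> manhattan D c r u w v -> v \in Y) ->
  \sum_(u <- X) \sum_(w <- X | near_in c r r u w) (f u - f w) ^+ 2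
    <= 25 * kappa ^+ 2 * r ^+ 4 * energy Y.
Proof.
move=> r1 XY; have K1 := mesh_ge1 R D; have k1 := stretch_ge1 R D.
have g0 := vertex_energy_ge0 Y.
pose H1 u v := near_in c (r + K) K u v; pose H2 u v := near_in c K (r + K) u v.
pose S (H : nat -> pred nat) := \sum_(u <- X) \sum_(w <- X | near_in c r r u w)
  \sum_(v <- Y | H u v) vertex_energy Y v.
have le_flow : \sum_(u <- X) \sum_(w <- X | near_in c r r u w) (f u - f w) ^+ 2
    <= kappa * r * (S H1 + S H2).
  (* By symmetry of [near_in], the strip at [w] contributes as much as if it were attached to [u],
     the form needed by [sum_incidence_le]. *)
  have -> : S H2 = \sum_(u <- X) \sum_(w <- X | near_in c r r u w)
      \sum_(v <- Y | H2 w v) vertex_energy Y v.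
    rewrite /S (exchange_big_dep xpredT)//=; apply: eq_bigr => w _.
    by apply: eq_bigl => u; rewrite near_in_sym.
  rewrite -big_split mulr_sumr /= big_seq [leRHS]big_seq; apply: ler_sum => u uX.
  rewrite -big_split mulr_sumr /= big_seq_cond [leRHS]big_seq_cond.
  apply: ler_sum => w /andP[wX uw].
  have [p [pp lp up pM ps]] := manhattan_path pc cG hD r1 uw.
  have pY : {subset u :: p <= Y} by move=> v vp; apply: (XY u w) => //; exact: pM.
  have := path_energy pp pY; rewrite lp => /le_trans; apply.
  apply: (@le_trans _ _ (kappa * r * \sum_(v <- u :: p) vertex_energy Y v)).
    by apply: ler_wpM2r => //; apply: sumr_ge0.
  apply: ler_wpM2l; first by nra.
  apply: le_trans (sum_orb_le _ _ _ g0).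
  by apply: sum_uniq_le => //; [exact: fset_uniq|move=> v vp; split; [exact: pY|exact: pM]].
have nu u : \sum_(w <- X | near_in c r r u w) 1 <= 25 * r ^+ 2.
  by apply: le_trans (count_near_in _ _ _ _) _; [lra|lra|nra].
(* One strip has half of the total [kappa * r]; it also bounds the number of strips containing a
   given vertex. *)
have strip : (4 * (r + K) + 1) * (4 * K + 1) <= kappa * r / 2.
  apply: (@le_trans _ _ ((9 * (K * r)) * (5 * K))); last by rewrite /stretch; lra.
  by apply: ler_pM; nra.
have b1 v : \sum_(u <- X | H1 u v) 1 <= kappa * r / 2.
  under eq_bigl do rewrite /H1 near_in_sym.
  by apply: le_trans (count_near_in _ _ _ _) strip; lra.
have b2 v : \sum_(u <- X | H2 u v) 1 <= kappa * r / 2.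
  under eq_bigl do rewrite /H2 near_in_sym.
  by apply: le_trans (count_near_in _ _ _ _) _; [lra|lra|rewrite mulrC].
have r20 : 0 <= 25 * r ^+ 2 by rewrite mulr_ge0// sqr_ge0.
have s1 := sum_incidence_le Y r20 g0 nu b1; have s2 := sum_incidence_le Y r20 g0 nu b2.
apply: (le_trans le_flow).
have -> : 25 * kappa ^+ 2 * r ^+ 4 * energy Y =
  kappa * r * (25 * r ^+ 2 * (kappa * r / 2) * energy Y + 25 * r ^+ 2 * (kappa * r / 2) * energy Y).
  by field.
by apply: ler_wpM2l; [nra|exact: lerD].
Qed.

Local Notation B := (ball_vertices c).

Lemma size_ball_gt0 x r : 0 <= r -> (0 < size (B x r))%N.
Proof. by move=> r0; have := volume_ge1 pc x r0; rewrite ler1n. Qed.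

Lemma ball_vertices_subpath x r u p v : path (adj c) u p -> last u p = x -> (size p)%:R <= r ->
  v \in u :: p -> v \in B x r.
Proof.
move=> pp lp pr; rewrite inE => /orP[/eqP->|]; first by apply/(ball_verticesP pc); exists p.
move=> vp; move: vp pp lp pr => /splitPr[p1 p2].
rewrite cat_path last_cat size_cat /= => /and3P[_ _ p2p] lp pr.
apply/(ball_verticesP pc); exists p2; split=> //; apply: le_trans pr.
by rewrite ler_nat addnS -addSn leq_addl.
Qed.

(** * Averages over balls of radius [rho] *)

Section local_averages.
Variables (x : nat) (r rho : R).
Hypotheses (rho1 : 1 <= rho) (rhor : rho <= r).

Let X := B x (r + rho).
(** The radius [3 * rho] covers pairs taken from two balls whose centers are within [rho], so one
    sum controls both the local deviations and the differences of averages. *)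
Let Lam := \sum_(u <- X) \sum_(w <- X | near_in c (3 * rho) (3 * rho) u w) (f u - f w) ^+ 2.
Let F y := average (B y rho) f.
Let nu := 4 * m ^+ 2 / rho ^+ 2.

Let rho_gt0 : 0 < rho. Proof. exact: lt_le_trans ltr01 rho1. Qed.

Let rho0 : 0 <= rho. Proof. exact: ltW. Qed.

Let ball_sub y u : y \in B x r -> u \in B y rho -> u \in X.
Proof. by move=> yB uB; exact: (ball_vertices_trans pc uB yB). Qed.

Let inv_volume y : 0 <= ((size (B y rho))%:R^-1 : R) <= nu.
Proof.
rewrite invr_ge0 ler0n /=.
have h := volume_lower pc cG hD y rho_gt0.
have s0 : 0 < (size (B y rho))%:R :> R by rewrite ltr0n size_ball_gt0.
by rewrite /nu ler_pdivlMr ?exprn_gt0// mulrC ler_pdivrMr.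
Qed.

Let near3 y y' u w : y' \in B y rho -> u \in B y rho -> w \in B y' rho ->
  near_in c (3 * rho) (3 * rho) u w.
Proof.
move=> /(ball_vertices_near pc) + /(ball_vertices_near pc) + /(ball_vertices_near pc).
rewrite /near_in !ler_norml => /andP[/andP[? ?] /andP[? ?]].
move=> /andP[/andP[? ?] /andP[? ?]] /andP[/andP[? ?] /andP[? ?]].
by apply/andP; split; apply/andP; split; lra.
Qed.

Lemma sum_local_average :
  \sum_(y <- B x r) (f y - F y) ^+ 2 <= nu * Lam.
Proof.
apply: (@le_trans _ _ (\sum_(y <- B x r) nu * \sum_(u <- B y rho) (f y - f u) ^+ 2)).
  apply: ler_sum => y _; apply: le_trans (average_sqr_le _ _ (size_ball_gt0 y rho0)) _.
  have /andP[_ h] := inv_volume y; apply: ler_wpM2r h.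
  by apply: sumr_ge0 => u _; exact: sqr_ge0.
rewrite -mulr_sumr; apply: ler_wpM2l.
  by have /andP[h1 h2] := inv_volume x; exact: le_trans h2.
apply: (@le_trans _ _ (\sum_(y <- B x r)
    \sum_(w <- X | near_in c (3 * rho) (3 * rho) y w) (f y - f w) ^+ 2)).
  rewrite big_seq [leRHS]big_seq; apply: ler_sum => y yB.
  apply: (sum_uniq_le (g := fun u => (f y - f u) ^+ 2));
    [exact: fset_uniq|exact: fset_uniq| |by move=> u; exact: sqr_ge0].
  move=> u uB; split; first exact: ball_sub uB.
  by apply: (near3 (y := y) (y' := y)) => //; exact: ball_vertices_center.
rewrite /Lam.
apply: (sum_uniq_le (P := xpredT) (g := fun y => \sum_(w <- X | near_in c (3 * rho) (3 * rho) y w) (f y - f w) ^+ 2));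
  [exact: fset_uniq|exact: fset_uniq| |].
- by move=> y yB; split=> //; apply: (ball_sub yB); exact: ball_vertices_center.
- by move=> y; apply: sumr_ge0 => w _; exact: sqr_ge0.
Qed.

(** Jensen's inequality is applied once for each ball; the two reciprocal volumes give [nu ^+ 2]. *)
Lemma average_step y y' : y \in B x r -> y' \in B x r -> y' \in B y rho ->
  `|F y - F y'| <= nu * Num.sqrt Lam.
Proof.
move=> yB y'B yy'.
have /andP[nu0 _] : 0 <= nu <= nu.
  by rewrite lexx andbT; have /andP[h1 h2] := inv_volume x; exact: le_trans h2.
have sq : (F y - F y') ^+ 2 <= nu * (nu * Lam).
  rewrite -sqrrN opprB.
  apply: le_trans (average_sqr_le _ _ (size_ball_gt0 y rho0)) _.
  have /andP[i0 i1] := inv_volume y; have /andP[j0 j1] := inv_volume y'.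
  apply: ler_pM => //; first by apply: sumr_ge0 => u _; exact: sqr_ge0.
  apply: (@le_trans _ _ (\sum_(u <- B y rho) nu * \sum_(w <- B y' rho) (f u - f w) ^+ 2)).
    apply: ler_sum => u _; rewrite -sqrrN opprB.
    apply: le_trans (average_sqr_le _ _ (size_ball_gt0 y' rho0)) _.
    by apply: ler_wpM2r j1; apply: sumr_ge0 => w _; exact: sqr_ge0.
  rewrite -mulr_sumr; apply: ler_wpM2l => //.
  apply: (@le_trans _ _ (\sum_(u <- B y rho)
      \sum_(w <- X | near_in c (3 * rho) (3 * rho) u w) (f u - f w) ^+ 2)).
    rewrite big_seq [leRHS]big_seq; apply: ler_sum => u uB.
    apply: (sum_uniq_le (g := fun w => (f u - f w) ^+ 2));
      [exact: fset_uniq|exact: fset_uniq| |by move=> w; exact: sqr_ge0].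
    move=> w wB; split; first exact: ball_sub wB.
    exact: near3 uB wB.
  apply: (sum_uniq_le (P := xpredT) (g := fun u => \sum_(w <- X | near_in c (3 * rho) (3 * rho) u w) (f u - f w) ^+ 2));
    [exact: fset_uniq|exact: fset_uniq| |].
  - by move=> u uB; split=> //; exact: ball_sub uB.
  - by move=> u; apply: sumr_ge0 => w _; exact: sqr_ge0.
rewrite -sqrtr_sqr; apply: le_trans (ler_wsqrtr sq) _.
by rewrite mulrA -expr2 sqrtrM ?sqr_ge0// sqrtr_sqr ger0_norm.
Qed.

(** The walk is cut into [k] pieces of at most [Num.truncn rho] edges, so consecutive cut points are
    within [rho] and [average_step] applies to each piece. *)
Lemma average_chain k y p : path (adj c) y p -> last y p = x -> (size p)%:R <= r ->
  (size p <= k * Num.truncn rho)%N -> `|F y - F x| <= k%:R * (nu * Num.sqrt Lam).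
Proof.
elim: k y p => [|k IH] y p pp lp pr.
  by rewrite mul0n leqn0 size_eq0 => /eqP p0; rewrite p0 /= in lp; rewrite lp subrr normr0 mul0r.
set n := Num.truncn rho => pk.
have n1 : n%:R <= rho by have /andP[] := truncn_itv rho0.
have yB : y \in B x r by apply/(ball_verticesP pc); exists p.
move: pp lp; rewrite -(cat_take_drop n p) cat_path last_cat.
set p1 := take n p; set p2 := drop n p; set z := last y p1 => /andP[pp1 pp2] lp2.
have sp1 : (size p1 <= n)%N by rewrite size_take_min geq_minl.
have sp2 : (size p2 <= k * n)%N by rewrite size_drop leq_subLR -mulSn.
have sp2r : (size p2)%:R <= r.
  by apply: le_trans pr; rewrite ler_nat size_drop leq_subr.
have zB : z \in B x r by apply/(ball_verticesP pc); exists p2.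
have yz : z \in B y rho.
  apply: ball_vertices_sym => //; apply/(ball_verticesP pc); exists p1; split=> //.
  by apply: le_trans n1; rewrite ler_nat.
have h1 := average_step yB zB yz; have h2 := IH z p2 pp2 lp2 sp2r sp2.
by apply: le_trans (ler_distD (F z) _ _) _; rewrite -natr1; lra.
Qed.

End local_averages.

(** Chosen so that the flow stays in the ball of radius [2 * r]: its vertices are within [kappa * (6
    * rho + K) <= 7 * K * kappa * rho] of a vertex at distance at most [r + rho], and these add up
    to [2 * r] when [r = scale * rho]. *)
Definition scale : R := 7 * K * kappa + 1.

(** Since [rho <= 2 * Num.truncn rho] for [rho >= 1], a walk of length at most [scale * rho] needs
    at most [2 * scale] pieces, rounded up. *)
Definition steps : nat := (Num.truncn (2 * scale)).+1.

(** The first term serves radii below [scale]. In the second, [45 ^+ 2] is [25 * 3 ^+ 4] from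
    [pair_energy] at [3 * rho], [8] is [2 * 4] from the local deviations, and [800] is [25 * 2 * 16]
    from the volume times the chained differences. *)
Definition poincare_constant : R := (4 * scale + 1) ^+ 2 +
  45 ^+ 2 * kappa ^+ 2 * (8 * m ^+ 2 + 800 * m ^+ 4 * steps%:R ^+ 2).

(** A free centering constant allows [f x] for small radii, where balls of radius [rho >= 1] would
    not fit the scale, and the average over [B x rho] for large ones. *)
Lemma poincare_center x r : 0 < r ->
  exists a, \sum_(y <- B x r) (f y - a) ^+ 2 <= poincare_constant * r ^+ 2 * energy (B x (2 * r)).
Proof.
move=> r0; have E0 := energy_ge0 (B x (2 * r)); set E := energy _ in E0 *.
have K1 := mesh_ge1 R D; have k1 := stretch_ge1 R D; have m1 := growth_ge1 R D.
have M1 : 1 <= scale by rewrite /scale; nra.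
have rE : 0 <= r ^+ 2 * E by rewrite mulr_ge0// sqr_ge0.
rewrite /poincare_constant; set q := 45 ^+ 2 * kappa ^+ 2.
have q0 : 0 <= q by rewrite mulr_ge0// sqr_ge0.
have km : 0 <= q * m ^+ 2 by rewrite mulr_ge0// sqr_ge0.
have kmm : 0 <= q * (m ^+ 4 * steps%:R ^+ 2).
  by rewrite mulr_ge0// mulr_ge0 ?sqr_ge0// exprn_ge0//; lra.
have [rM|Mr] := ltP r scale.
  exists (f x).
  have le1 y : y \in B x r -> (f y - f x) ^+ 2 <= r ^+ 2 * E.
    move=> /(ball_verticesP pc)[p [pp lp pr]].
    (* Without repeated vertices, the sum along the path is bounded by the energy of the whole
       ball. *)
    move: lp pr; case: (shortenP pp) => p' pp' up' sub lp' pr.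
    have {}pr : (size p')%:R <= r.
      by apply: le_trans pr; rewrite ler_nat uniq_leq_size//; case/andP: up'.
    have pB v : v \in y :: p' -> v \in B x (2 * r).
      move=> /(ball_vertices_subpath pp' lp' pr); apply: ball_vertices_le => //; lra.
    have := path_energy pp' pB; rewrite lp' => /le_trans; apply.
    apply: ler_pM => //; first by apply: sumr_ge0 => v _; exact: vertex_energy_ge0.
      (* The length is an integer, so it is at most its square; this gives [r ^+ 2] even when
         [r < 1]. *)
      apply: (@le_trans _ _ ((size p')%:R ^+ 2)).
        by rewrite -natrX ler_nat; case: (size p') => // n; rewrite -mulnn leq_pmulr.
      by rewrite ler_sqr ?nnegrE//; exact: ltW.
    rewrite /E /energy; apply: (sum_uniq_le (P := xpredT)) => //; first exact: fset_uniq.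
      by move=> v /pB.
    exact: vertex_energy_ge0.
  apply: (@le_trans _ _ ((size (B x r))%:R * (r ^+ 2 * E))).
    rewrite mulr_natl -[size _]/(size (B x r)) -(count_predT (B x r)) -iter_addr_0 -big_const_seq.
    by rewrite big_seq [leRHS]big_seq; apply: ler_sum => y; exact: le1.
  rewrite -mulrA; apply: ler_wpM2r => //.
  have := volume_upper pc x (ltW r0).
  have : (4 * r + 1) ^+ 2 <= (4 * scale + 1) ^+ 2.
    by rewrite ler_sqr ?nnegrE; lra.
  lra.
have scale0 : 0 < scale by lra.
have [rho [rE' rho1 rhor]] : exists rho, [/\ r = scale * rho, 1 <= rho & rho <= r].
  exists (r / scale); rewrite ler_pdivlMr// mul1r ler_pdivrMr//.
  by split=> //; [rewrite mulrC divfK// gt_eqF|nra].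
set a := average (B x rho) f; exists a.
have Lam_le := @pair_energy (B x (r + rho)) (B x (2 * r)) (3 * rho) ltac:(lra).
set Lam := \sum_(u <- _) _ in Lam_le.
have {}Lam_le : Lam <= q * rho ^+ 4 * E.
  have -> : q * rho ^+ 4 * E = 25 * kappa ^+ 2 * (3 * rho) ^+ 4 * E by rewrite /q; ring.
  apply: Lam_le.
  have rho3 : 0 <= 3 * rho by lra.
  move=> u w v uX wX uw /(manhattan_near rho3 uw) uv.
  have big1 : 1 <= 3 * rho + 3 * rho + K by lra.
  have := ball_vertices_trans pc (near_ball_vertices pc cG hD big1 uv) uX.
  apply: ball_vertices_le => //.
  have rS : r = 7 * K * kappa * rho + rho by rewrite {1}rE' /scale; ring.
  have kr : 0 <= kappa * rho by apply: mulr_ge0; lra.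
  have kK : 0 <= kappa * K by apply: mulr_ge0; lra.
  have h1 : 0 <= (K - 1) * (kappa * rho) by apply: mulr_ge0 => //; lra.
  have h2 : 0 <= kappa * K * (rho - 1) by apply: mulr_ge0 => //; lra.
  by lra.
have Lam0 : 0 <= Lam.
  by apply: sumr_ge0 => u _; apply: sumr_ge0 => w _; exact: sqr_ge0.
move: q q0 km kmm Lam_le => q q0 km kmm Lam_le.
pose nu := 4 * m ^+ 2 / rho ^+ 2.
pose A := nu * Num.sqrt Lam.
have A2 : A ^+ 2 = nu ^+ 2 * Lam by rewrite exprMn sqr_sqrtr.
have A0 : 0 <= A by rewrite mulr_ge0 ?sqrtr_ge0// divr_ge0 ?sqr_ge0// mulr_ge0// sqr_ge0.
have chain y : y \in B x r -> (average (B y rho) f - a) ^+ 2 <= steps%:R ^+ 2 * (nu ^+ 2 * Lam).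
  move=> /(ball_verticesP pc)[p [pp lp pr]].
  have : (size p <= steps * Num.truncn rho)%N.
    have rho0 : 0 <= rho by lra.
    have /andP[t1 t2] := truncn_itv rho0.
    have t3 : rho <= 2 * (Num.truncn rho)%:R.
      have : 1 <= (Num.truncn rho)%:R :> R by rewrite ler1n truncn_gt0.
      by move: t2; rewrite -natr1; lra.
    rewrite -(ler_nat R) natrM; apply: (le_trans pr).
    have s0 : 0 <= 2 * scale by lra.
    have /andP[_ s1] := truncn_itv s0.
    rewrite rE' /steps; nra.
  move=> /(average_chain rho1 pp lp pr) h.
  rewrite -A2 -exprMn -[leLHS]real_normK ?num_real// ler_sqr ?nnegrE//.
  by rewrite mulr_ge0.
have local := sum_local_average x r rho1.
apply: (@le_trans _ _ (\sum_(y <- B x r) (2 * (f y - average (B y rho) f) ^+ 2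
    + 2 * (steps%:R ^+ 2 * (nu ^+ 2 * Lam))))).
  rewrite big_seq [leRHS]big_seq; apply: ler_sum => y /chain.
  move: (average _ _) => b h; have := sqr_ge0 (f y - b - (b - a)); nra.
rewrite big_split /= -mulr_sumr big_const_seq count_predT iter_addr_0 -[X in _ + X]mulr_natl.
have vol : (size (B x r))%:R <= 25 * r ^+ 2.
  by apply: le_trans (volume_upper pc x (ltW r0)) _; nra.
have nuL : nu * Lam <= 4 * q * m ^+ 2 * (rho ^+ 2 * E).
  have -> : 4 * q * m ^+ 2 * (rho ^+ 2 * E) =
    nu * (q * rho ^+ 4 * E) by rewrite /nu; field; lra.
  by apply: ler_wpM2l => //; rewrite divr_ge0 ?sqr_ge0// mulr_ge0// sqr_ge0.
have nuL2 : nu ^+ 2 * Lam <= 16 * q * m ^+ 4 * E.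
  have -> : 16 * q * m ^+ 4 * E =
    nu ^+ 2 * (q * rho ^+ 4 * E) by rewrite /nu; field; lra.
  by apply: ler_wpM2l => //; exact: sqr_ge0.
have rr : rho ^+ 2 * E <= r ^+ 2 * E.
  have rr : rho * rho <= r * r by apply: ler_pM => //; lra.
  by rewrite !expr2; exact: ler_wpM2r.
have part1 : 2 * \sum_(y <- B x r) (f y - average (B y rho) f) ^+ 2
    <= 2 * (4 * (q * m ^+ 2) * (r ^+ 2 * E)).
  apply: ler_wpM2l => //; apply: (le_trans local); apply: (le_trans nuL).
  have := ler_wpM2l km rr; lra.
have part2 : (size (B x r))%:R * (2 * (steps%:R ^+ 2 * (nu ^+ 2 * Lam)))
    <= 25 * r ^+ 2 * (2 * (steps%:R ^+ 2 * (16 * q * m ^+ 4 * E))).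
  have s2 : 0 <= steps%:R ^+ 2 :> R by exact: sqr_ge0.
  have n2 : 0 <= nu ^+ 2 * Lam by rewrite -A2 sqr_ge0.
  have s2n2 := mulr_ge0 s2 n2.
  apply: ler_pM => //; first exact: mulr_ge0.
  by apply: ler_wpM2l => //; exact: ler_wpM2l.
apply: (le_trans (lerD part1 part2)).
have := mulr_ge0 (sqr_ge0 (4 * scale + 1)) rE; lra.
Qed.

Lemma poincare x r : 0 < r ->
  \sum_(y <- B x r) (f y - average (B x r) f) ^+ 2
    <= poincare_constant * r ^+ 2 * energy (B x (2 * r)).
Proof.
move=> r0; have [a h] := poincare_center x r0; apply: le_trans h.
rewrite (variance_identity f a (size_ball_gt0 x (ltW r0))) lerDl.
by rewrite mulr_ge0// sqr_ge0.
Qed.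

End penny_graph.

(** * Translation to the sums over sets, and the constants *)

Lemma energy_fsbig (R : realType) (c : nat -> R * R) (f : nat -> R) (A : set nat) :
  finite_set A ->
  \sum_(e \in [set e : nat * nat | [/\ A e.1, A e.2 & adj c e.1 e.2]])
      `|f e.1 - f e.2| ^+ 2 = energy c f (fset_set A).
Proof.
move=> fA; have fE : finite_set [set e : nat * nat | [/\ A e.1, A e.2 & adj c e.1 e.2]].
  by apply: (sub_finite_set _ (finite_setX fA fA)) => e [].
rewrite fsbig_finite// (perm_big [seq e <- [seq (v, w) | v <- fset_set A, w <- fset_set A] | adj c e.1 e.2]) /=.
  rewrite big_filter big_mkcond big_allpairs /energy; apply: eq_bigr => v _.
  rewrite -big_mkcond /vertex_energy; apply: eq_bigr => w _.
  by rewrite real_normK ?num_real.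
apply: uniq_perm; first exact: fset_uniq.
  by apply/filter_uniq/allpairs_uniq; rewrite ?fset_uniq// => -[? ?] [? ?].
move=> e; rewrite in_fset_set// mem_filter.
apply/idP/andP => [/set_mem[Av Aw vw]|[vw /allpairsP[[v w] /= [vA wA E]]]].
  split=> //; apply/allpairsP; exists e; rewrite -surjective_pairing !in_fset_set//.
  by split=> //; exact/mem_set.
by move: vw; rewrite E /= => vw; apply/mem_set; move: vA wA;
  rewrite !in_fset_set// => /set_mem vA /set_mem wA.
Qed.

Lemma poincare_constant_gt0 (R : realType) (D : nat) : 0 < poincare_constant R D.
Proof.
have K1 := mesh_ge1 R D; have k1 := stretch_ge1 R D.
have Kk : 0 <= mesh R D * stretch R D by apply: mulr_ge0; lra.
have scale_gt0 : 0 < scale R D by rewrite /scale; lra.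
rewrite /poincare_constant.
apply: ltr_pwDl; first by apply: exprn_gt0; lra.
apply: mulr_ge0; first by apply: mulr_ge0; exact: sqr_ge0.
apply: addr_ge0; first by apply: mulr_ge0 => //; exact: sqr_ge0.
apply: mulr_ge0; last exact: sqr_ge0.
apply: mulr_ge0; first exact: ler0n.
exact: exprn_even_ge0.
Qed.

Theorem theorem1p2 (R : realType) (D : nat) :
  exists C1 C : R, [/\ 0 < C1, 0 < C &
    forall c : nat -> R * R,
      penny_packing c ->
      graph_connected (adj c) ->
      (ereal_sup [set facial_degree c U | U in faces c] <= D%:R%:E)%E ->
      (forall (x : nat) (r : R), 0 < r ->
         ncard R (graph_ball (adj c) x (2 * r))
           <= C1 * ncard R (graph_ball (adj c) x r)) /\
      (forall (x : nat) (r : R) (f : nat -> R), 0 < r ->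
         \sum_(y \in graph_ball (adj c) x r)
             `|f y - mean (graph_ball (adj c) x r) f| ^+ 2
           <= C * r ^+ 2 *
              \sum_(e \in [set e : nat * nat |
                             [/\ graph_ball (adj c) x (2 * r) e.1,
                                 graph_ball (adj c) x (2 * r) e.2 &
                                 adj c e.1 e.2]])
                `|f e.1 - f e.2| ^+ 2)].
Proof.
exists (512 * growth R D ^+ 2 + 2), (poincare_constant R D); split.
- by have := sqr_ge0 (growth R D); lra.
- exact: poincare_constant_gt0.
move=> c pc cG hD; split=> [x r r0|x r f r0]; first exact: volume_doubling.
have fin (s : R) : finite_set (graph_ball (adj c) x s) by exact: (graph_ball_finite _ _ pc).
rewrite (energy_fsbig c f (fin (2 * r))) (fsbig_finite _ _ (fin r)).
have -> : mean (graph_ball (adj c) x r) f = average (ball_vertices c x r) f.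
  by rewrite /mean /average (fsbig_finite _ _ (fin r)).
under eq_bigr do rewrite real_normK ?num_real//.
exact: poincare.
Qed.
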